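(* Let $n\geqslant 1$, let $K$ be a field, let $R=K[x_1,\ldots,x_n]$, and let $\mathcal{H}$ be a unimodular hypergraph on the vertex set $\{1,\ldots,n\}$ with cover ideal $J(\mathcal{H})\subseteq R$. Then for any $i$ with $0\leqslant i\leqslant \dim R/J(\mathcal{H})$, either $a_i(R/J(\mathcal{H})^s)=-\infty$ for all $s\geqslant 1$, or there are positive integers $d$ and $e$ with $d\leqslant e$ such that $a_i(R/J(\mathcal{H})^s)=ds-e$ for all integers $s\geqslant n^2$.
   Context: $R=K[x_1,\ldots,x_n]$ carries the standard grading and $\mathfrak{m}=(x_1,\ldots,x_n)$. For a finitely generated graded $R$-module $M$ and $i=0,\ldots,\dim M$, $a_i(M)=\max\{t\in\mathbb{Z}\mid H^i_{\mathfrak{m}}(M)_t\neq 0\}$, where $H^i_{\mathfrak{m}}(M)$ is the $i$-th local cohomology module of $M$ with support in $\mathfrak{m}$ and $\max\emptyset=-\infty$. A hypergraph $\mathcal{H}=(\mathcal{V},\mathcal{E})$ consists of a vertex set $\mathcal{V}=\{1,\ldots,n\}$ and a family $\mathcal{E}=\{E_1,\ldots,E_m\}$ of distinct nonempty subsets of $\mathcal{V}$ (edges). Its incidence matrix is the $n\times m$ matrix $A(\mathcal{H})=(a_{ij})$ with $a_{ij}=1$ if $i\in E_j$ and $a_{ij}=0$ otherwise. $\mathcal{H}$ is unimodular if $A(\mathcal{H})$ is totally unimodular, i.e. every square submatrix has determinant $0$, $1$ or $-1$. A vertex cover of $\mathcal{H}$ is a subset of $\mathcal{V}$ meeting every edge;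 it is minimal if no proper subset is a vertex cover. For $\tau\subseteq\mathcal{V}$ put $\mathbf{x}_\tau=\prod_{i\in\tau}x_i$. The cover ideal is $J(\mathcal{H})=(\mathbf{x}_\tau\mid \tau \text{ a minimal vertex cover of }\mathcal{H})$; equivalently $J(\mathcal{H})=\bigcap_{E\in\mathcal{E}}(x_i\mid i\in E)$. $J(\mathcal{H})^s$ is the ordinary $s$-th power. *)

(* Defs.v *)
From HB Require Import structures.
From mathcomp Require Import all_boot all_order all_algebra.
From mathcomp Require Import ring_quotient fraction.
From mathcomp Require Import mpoly.

Set Implicit Arguments.
Unset Strict Implicit.
Unset Printing Implicit Defensive.

Import Order.TTheory GRing.Theory Num.Theory.

Local Open Scope ring_scope.

Record hypergraph (n : nat) := Hypergraph {
  edges : {set {set 'I_n}};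
  edges_nonempty : set0 \notin edges
}.

(* The columns are indexed by an enumeration of the edges. *)
Definition incidence_mx n (H : hypergraph n) : 'M[int]_(n, #|edges H|) :=
  \matrix_(i < n, j < #|edges H|)
    (i \in (enum_val j : {set 'I_n}))%:R.

(* A square submatrix is given by a choice of distinct rows and distinct
   columns; their order affects the determinant only by a sign. *)
Definition totally_unimodular m p (A : 'M[int]_(m, p)) : Prop :=
  forall (k : nat) (f : 'I_k -> 'I_m) (g : 'I_k -> 'I_p),
    injective f -> injective g ->
    \det (mxsub f g A) \in [:: 0; 1; -1].

Definition unimodular n (H : hypergraph n) : Prop :=
  totally_unimodular (incidence_mx H).

Definition vertex_cover n (H : hypergraph n) (T : {set 'I_n}) : bool :=
  [forall (E | E \in edges H), T :&: E != set0].

Definition min_vertex_cover n (H : hypergraph n) (T : {set 'I_n}) : bool :=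
  minset (vertex_cover H) T.

Section Ideals.
Variables (n : nat) (K : fieldType).
Local Notation R := {mpoly K[n]}.

Definition ideal_gen (G : R -> Prop) : R -> Prop :=
  fun f => exists (m : nat) (a g : 'I_m -> R),
    (forall k, G (g k)) /\ f = \sum_(k < m) a k * g k.

Definition ideal_exp (I : R -> Prop) (s : nat) : R -> Prop :=
  ideal_gen (fun f => exists h : 'I_s -> R,
    (forall k, I (h k)) /\ f = \prod_(k < s) h k).

Definition xprod (S : {set 'I_n}) : R := \prod_(j in S) 'X_j.

Definition cover_ideal (H : hypergraph n) : R -> Prop :=
  ideal_gen (fun f => exists2 T, min_vertex_cover H T & f = xprod T).

(* [idealr_closed] includes properness. *)
Definition prime_ideal (P : {pred R}) : Prop :=
  idealr_closed P /\ prime_idealr_closed P.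

(* i <= dim R/I, the Krull dimension being the supremum of the lengths l of
   the chains P_0 < ... < P_l of primes containing I; in particular no i
   satisfies this when I is the unit ideal. *)
Definition le_dim_quot (i : nat) (I : R -> Prop) : Prop :=
  exists (l : nat) (P : nat -> {pred R}),
    [/\ (i <= l)%N,
        forall k, (k <= l)%N -> prime_ideal (P k),
        forall k, (k <= l)%N -> forall f, I f -> f \in P k
      & forall k, (k < l)%N ->
          {subset P k <= P k.+1} /\ ~ {subset P k.+1 <= P k}].

(* For a homogeneous ideal I, the local cohomology H^i(R/I) with support in
   (x_1, ..., x_n) is the i-th cohomology of the Cech complex of R/I on the variables,
     C^i = \bigoplus_(#|S| = i) (R/I)_(x_S),  x_S = \prod_(j in S) x_j.
   Each localization R_(x_S) is realized inside the fraction field of R, and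
   (R/I)_(x_S) as R_(x_S) / I R_(x_S).  The differential preserves degrees, so
   H^i(R/I)_t is the i-th cohomology of the degree t strand. *)

Local Notation F := {fraction R}.

(* The zero polynomial is the only one that is homogeneous of negative
   degree. *)
Definition int_homog (d : int) (p : R) : bool :=
  if d is Posz m then p \is m.-homog else p == 0.

(* The degree t component of R_(x_S). *)
Definition loc_homog (S : {set 'I_n}) (t : int) (c : F) : Prop :=
  exists (p : R) (k : nat),
    int_homog (t + (k * #|S|)%:Z) p /\ c = tofrac p / tofrac (xprod S) ^+ k.

(* The extended ideal I R_(x_S). *)
Definition loc_ideal (I : R -> Prop) (S : {set 'I_n}) (c : F) : Prop :=
  exists (p : R) (k : nat),
    I p /\ c = tofrac p / tofrac (xprod S) ^+ k.

(* Only the values c S with #|S| = i matter for an i-cochain c. *)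
Definition cech_cochain (i : nat) (t : int) (c : {set 'I_n} -> F) : Prop :=
  forall S : {set 'I_n}, #|S| = i -> loc_homog S t (c S).

Definition cech_diff (c : {set 'I_n} -> F) (T : {set 'I_n}) : F :=
  \sum_(j in T) (-1) ^+ #|[set k in T | (k < j)%N]| * c (T :\ j).

Definition cech_cocycle (I : R -> Prop) (i : nat) (c : {set 'I_n} -> F) :
    Prop :=
  forall T : {set 'I_n}, #|T| = i.+1 -> loc_ideal I T (cech_diff c T).

(* For i = 0 the differential of b at S = set0 is an empty sum, so that only
   zero is a coboundary. *)
Definition cech_coboundary (I : R -> Prop) (i : nat) (t : int)
    (c : {set 'I_n} -> F) : Prop :=
  exists b : {set 'I_n} -> F, cech_cochain i.-1 t b /\
    forall S : {set 'I_n}, #|S| = i -> loc_ideal I S (c S - cech_diff b S).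

Definition local_cohomology_neq0 (I : R -> Prop) (i : nat) (t : int) : Prop :=
  exists c : {set 'I_n} -> F,
    [/\ cech_cochain i t c, cech_cocycle I i c & ~ cech_coboundary I i t c].

(* a_i(R/I) = a, where None stands for -oo. *)
Definition is_a_invariant (I : R -> Prop) (i : nat) (a : option int) : Prop :=
  match a with
  | Some t => local_cohomology_neq0 I i t /\
      forall t', local_cohomology_neq0 I i t' -> t' <= t
  | None => forall t, ~ local_cohomology_neq0 I i t
  end.

End Ideals.

(* Main.v *)
Require Import Defs.
From HB Require Import structures.
From mathcomp Require Import all_boot all_order all_algebra.
From mathcomp Require Import ring_quotient fraction.
From mathcomp Require Import mpoly.
From mathcomp Require Import zify ring.
From Stdlib Require Import Classical ClassicalEpsilon.

Set Implicit Arguments.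
Unset Strict Implicit.
Unset Printing Implicit Defensive.

Import Order.TTheory GRing.Theory Num.Theory.

Local Open Scope ring_scope.

(** Write a(E) for the sum of a over E, and J for the cover ideal.

    Reduction to combinatorics.  All the objects are graded by exponents a in
    Z^n, and total unimodularity makes J^s a monomial ideal with a simple
    description: x^m lies in J^s iff m(E) >= s for every edge E
    ([cover_powerP]).  The degree a strand of the Cech complex of R/J^s has a
    basis element for each S that contains G = {i | a_i < 0} and misses some
    edge E, disjoint from G, with a(E) < s.  So whether H^i(R/J^s)_a vanishes
    depends only on G and on the set B of these edges ([local_cohomologyP], a
    form of Takayama's formula), and a_i(R/J^s) is the largest total degree of
    an exponent a whose pair (G, B) has a nontrivial strand.  Call such a pair
    good if it occurs for some s >= 1; if none does, then a_i(R/J^s) is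
    -infinity for all s >= 1.

    Optimization.  Fix a good pair.  If some i outside G lay in no E in B, the
    strand would be a cone with apex i and hence acyclic
    ([acyclic_at_cone]); so the coordinates outside G are bounded.  Those in G
    may be taken equal to -1.  The largest total degree f(s) is then the value
    of an integer program with constraints a(E) <= s - 1 for E in B and
    a(E) >= s for the other edges disjoint from G.  By total unimodularity the
    optimum is attained at a vertex a = s u - v with u and v integral and all
    |v_i| <= n.  For s > n^2 these bounds on v force a - u to be feasible for
    s - 1, and u to be feasible for the limit program: u = 0 on G, u >= 0,
    u(E) <= 1 for E in B, and u(E) >= 1 for the other edges disjoint from G.
    With d the optimum of the limit program, f(s) <= f(s - 1) + d; adding an
    optimal u gives the opposite inequality.  Hence f(s) = ds - e from n^2 on
    ([region_growth]).  Moreover e = v_1 + ... + v_n <= n^2 by the bound on v,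
    and d <= e because an optimal a, with its coordinates in G replaced by
    0 and rescaled by 1/(s - 1), is feasible for the limit program.

    Comparison.  Among the good pairs choose the largest d and then the
    smallest e.  As 0 <= e <= n^2, the line ds - e dominates all others on
    s >= n^2. *)

(** * Total unimodularity and vertices of polyhedra *)

Lemma totally_unimodular_tr m p (A : 'M[int]_(m, p)) :
  totally_unimodular A -> totally_unimodular A^T.
Proof.
move=> tuA k f g fI gI; rewrite -det_tr.
have -> : (mxsub f g A^T)^T = mxsub g f A by apply/matrixP=> i j; rewrite !mxE.
exact: tuA.
Qed.

(** Constraints on single coordinates do not spoil total unimodularity: a minor that
    uses a unit row is expanded along it. *)
Lemma totally_unimodular_id m p (A : 'M[int]_(m, p)) :
  totally_unimodular A -> totally_unimodular (col_mx A 1%:M).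
Proof.
move=> tuA; elim=> [|k IH] f g fI gI; first by rewrite det_mx00 !inE eqxx orbT.
have sgnM a b : b \in [:: 0; 1; -1] -> ((-1) ^+ a * b : int) \in [:: 0; 1; -1].
  by rewrite -signr_odd !inE; case: (odd a); move=> /or3P[] /eqP->.
have [/existsP[j /existsP[r /eqP frE]]|nofr] :=
    boolP [exists j, exists r, f j == rshift m r].
- have rowE l : mxsub f g (col_mx A 1%:M) j l = (g l == r)%:R.
    by rewrite mxE frE col_mxEd mxE eq_sym.
  rewrite (expand_det_row _ j).
  have [/existsP[l /eqP glr]|nog] := boolP [exists l, g l == r]; last first.
    rewrite big1 ?inE ?eqxx // => l _; rewrite rowE.
    by move: nog; rewrite negb_exists => /forallP/(_ l)/negPf->; rewrite mul0r.
  rewrite (bigD1 l) //= big1 ?addr0 => [|l' ll']; last first.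
    by rewrite rowE -glr (inj_eq gI) (negPf ll') mul0r.
  rewrite rowE glr eqxx mul1r /cofactor; apply: sgnM.
  have -> : row' j (col' l (mxsub f g (col_mx A 1%:M)))
          = mxsub (f \o lift j) (g \o lift l) (col_mx A 1%:M).
    by apply/matrixP=> a b; rewrite !mxE.
  by apply: IH; apply: inj_comp => //; apply: lift_inj.
- have fl j : exists r, f j == lshift p r.
    case: (split_ordP (f j)) => r fE; first by exists r; rewrite fE.
    by case/existsP: nofr; exists j; apply/existsP; exists r; rewrite fE.
  pose f' j := xchoose (fl j).
  have f'E j : f j = lshift p (f' j) by apply/eqP/(xchooseP (fl j)).
  have -> : mxsub f g (col_mx A 1%:M) = mxsub f' g A.
    by apply/matrixP=> a b; rewrite mxE f'E col_mxEu mxE.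
  by apply: tuA => // a b ab; apply: fI; rewrite !f'E ab.
Qed.

(** The fundamental theorem of linear programming.  If some direction y is
    orthogonal to all tight constraints, move along y or -y, whichever does not
    decrease the objective, until a further constraint becomes tight; this
    happens because the polyhedron contains no half-line.  The last clause says
    that x' is a vertex. *)
Lemma polyhedron_vertex n (J : finType) (P : pred J) (W : J -> 'I_n -> rat)
    (w : J -> rat) (c x : 'I_n -> rat) :
  (forall y : 'I_n -> rat,
     (forall j, P j -> \sum_i W j i * y i <= 0) -> forall i, y i = 0) ->
  (forall j, P j -> \sum_i W j i * x i <= w j) ->
  exists x' : 'I_n -> rat,
    [/\ forall j, P j -> \sum_i W j i * x' i <= w j,
        \sum_i c i * x i <= \sum_i c i * x' i
      & forall y : 'I_n -> rat,
          (forall j, P j -> \sum_i W j i * x' i = w j ->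
             \sum_i W j i * y i = 0) ->
          forall i, y i = 0].
Proof.
move=> bnd; pose dot (a b : 'I_n -> rat) := \sum_i a i * b i.
pose slack (z : 'I_n -> rat) := [set j | P j & dot (W j) z != w j].
have [N] := ubnP #|slack x|; elim: N x => // N IH x slackx feasx.
case: (classic (forall y : 'I_n -> rat,
  (forall j, P j -> dot (W j) x = w j -> dot (W j) y = 0) ->
  forall i, y i = 0)) => [basic|nbasic]; first by exists x.
have {nbasic}[y [yz cy [i0 yi0]]] : exists y : 'I_n -> rat,
    [/\ forall j, P j -> dot (W j) x = w j -> dot (W j) y = 0,
        0 <= dot c y & exists i, y i <> 0].
  apply: NNPP => H; apply: nbasic => y Hy i; apply: NNPP => Hi; apply: H.
  have dotN a : dot a (fun i => - y i) = - dot a y.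
    by rewrite /dot -sumrN; apply: eq_bigr => k _; rewrite mulrN.
  have [cy|cy] := leP 0 (dot c y); first by exists y; split=> //; exists i.
  exists (fun i => - y i); split.
  - by move=> j Pj jx; rewrite dotN Hy ?oppr0.
  - by rewrite dotN oppr_ge0 ltW.
  - by exists i; apply/eqP; rewrite oppr_eq0; apply/eqP.
have [j0 /andP[Pj0 j0y]] : exists j, P j && (0 < dot (W j) y).
  apply: NNPP => H; apply: yi0; apply: bnd => j Pj; rewrite leNgt.
  by apply/negP => jy; apply: H; exists j; rewrite Pj; exact: jy.
have slackj j : P j -> 0 < dot (W j) y -> j \in slack x.
  by move=> Pj jy; rewrite inE Pj /=; apply/eqP => jx; rewrite yz ?ltxx in jy.
(* [step j] is the time at which constraint j becomes tight along y; the least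
   one keeps all the constraints satisfied. *)
pose step j := (w j - dot (W j) x) / dot (W j) y.
pose Q j := P j && (0 < dot (W j) y).
have Qj0 : Q j0 by rewrite /Q Pj0.
case: (arg_minP step Qj0) => j1 /andP[Pj1 j1y] minj1.
pose t := step j1.
have t0 : 0 <= t by rewrite divr_ge0 ?(ltW j1y) // subr_ge0; apply: feasx.
pose x1 i := x i + t * y i.
have dotx1 a : dot a x1 = dot a x + t * dot a y.
  rewrite /dot mulr_sumr -big_split; apply: eq_bigr => i _.
  by rewrite mulrDr mulrCA.
have tight1 : dot (W j1) x1 = w j1.
  by rewrite dotx1 /t /step divfK ?lt0r_neq0 // addrC subrK.
have [|j Pj|x' [feas' obj' basic']] := IH x1.
- rewrite -ltnS; apply: leq_trans slackx; rewrite ltnS; apply: proper_card.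
  apply/properP; split; last first.
    by exists j1; [exact: slackj|rewrite inE Pj1 tight1 eqxx].
  apply/subsetP => j; rewrite !inE => /andP[Pj]; rewrite Pj /=.
  by apply: contraNneq => jx; rewrite dotx1 jx yz // mulr0 addr0.
- rewrite -/(dot _ _) dotx1; have [jy|jy] := leP (dot (W j) y) 0.
    by rewrite (le_trans _ (feasx j Pj)) // gerDl mulr_ge0_le0.
  rewrite -lerBrDl -ler_pdivlMr //; apply: (minj1 j).
  by rewrite /Q Pj.
exists x'; split=> //; apply: le_trans obj'.
by rewrite -!/(dot _ _) dotx1 lerDl mulr_ge0.
Qed.
(** Cramer's rule: rows of T with trivial common kernel contain a nonsingular
    n x n submatrix, whose determinant is 1 or -1.  Its inverse N is therefore
    its adjugate up to sign, with entries minors of W up to sign.  This is the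
    source of all the integrality and of the bound |v_i| <= n. *)
Lemma unimodular_basis p n (W : 'M[int]_(p, n)) (T : pred 'I_p) :
  totally_unimodular W ->
  (forall y : 'I_n -> rat,
     (forall r, T r -> \sum_i (W r i)%:~R * y i = 0) -> forall i, y i = 0) ->
  exists (N : 'M[int]_n) (f : 'I_n -> 'I_p),
    [/\ forall j, T (f j), forall i j, `|N i j| <= 1
      & forall (x : 'I_n -> rat) i,
          x i = \sum_j (N i j)%:~R * \sum_l (W (f j) l)%:~R * x l].
Proof.
move=> tuW kerT.
pose WT : 'M[rat]_(p, n) := \matrix_(r, i) ((W r i)%:~R *+ T r).
have fullWT : row_full WT.
  rewrite /row_full -mxrank_tr -[_ == _]/(row_free WT^T) -kermx_eq0.
  apply/eqP/row_matrixP => k; rewrite row0.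
  have : row k (kermx WT^T) *m WT^T = 0.
    by rewrite -row_mul mulmx_ker row0.
  move: (row k _) => y yWT; apply/rowP => i; rewrite mxE.
  apply: (kerT (fun i => y 0 i)) => r Tr.
  move/rowP/(_ r): yWT; rewrite !mxE => yWT; rewrite -[RHS]yWT.
  by apply: eq_bigr => l _; rewrite !mxE Tr mulr1n mulrC.
pose f := fullrankfun fullWT.
have fI : injective f by apply: fullrankfun_inj.
have unitf : rowsub f WT \in unitmx by apply: fullrowsub_unit.
have Tf j : T (f j).
  apply: contraLR unitf => nTj; rewrite unitmxE unitfE negbK.
  rewrite (expand_det_row _ j) big1 // => l _.
  by rewrite !mxE (negPf nTj) mul0r.
pose M := rowsub f W.
have Mrat : map_mx intr M = rowsub f WT.
  by apply/matrixP => j l; rewrite !mxE Tf.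
have tuM : \det M \in [:: 0; 1; -1].
  have -> : M = mxsub f id W by [].
  exact: tuW.
have dM1 : \det M * \det M = 1.
  have : \det M != 0.
    move: unitf; rewrite -Mrat unitmxE det_map_mx unitfE.
    by apply: contraNneq => ->; rewrite rmorph0.
  by move: tuM; rewrite !inE => /or3P[] /eqP->.
have M1 : `|\det M| <= 1 by move: tuM; rewrite !inE => /or3P[] /eqP->.
exists (\det M *: \adj M), f; split=> // [i j|x i].
  rewrite !mxE normrM; apply: mulr_ile1 => //.
  rewrite /cofactor normrM normrX normrN1 expr1n mul1r.
  have -> : row' j (col' i M) = mxsub (f \o lift j) (lift i) W.
    by apply/matrixP => a b; rewrite !mxE.
  have : \det (mxsub (f \o lift j) (lift i) W) \in [:: 0; 1; -1].
    by apply: tuW; [apply: inj_comp => //|]; apply: lift_inj.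
  by rewrite !inE => /or3P[] /eqP->.
have NM : \det M *: \adj M *m M = 1%:M.
  by rewrite -scalemxAl mul_adj_mx scale_scalar_mx dM1.
pose X : 'cV[rat]_n := \col_l x l.
have : map_mx intr (\det M *: \adj M *m M) *m X = X by rewrite NM map_mx1 mul1mx.
rewrite map_mxM -mulmxA => /colP/(_ i); rewrite !mxE => <-.
apply: eq_bigr => j _; rewrite !mxE; congr (_ * _).
by apply: eq_bigr => l _; rewrite !mxE.
Qed.

(** * Rounding for unimodular hypergraphs *)

Section Polytopes.
Variables (n : nat) (H : hypergraph n).
Hypothesis HU : unimodular H.

Let m := #|edges H|.
Let functional_mx := col_mx (incidence_mx H)^T (1%:M : 'M[int]_n).

Lemma sum_row_edge (x : 'I_n -> rat) (r : 'I_m) :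
  \sum_i (functional_mx (lshift n r) i)%:~R * x i
  = \sum_(i in (enum_val r : {set 'I_n})) x i.
Proof.
rewrite [RHS]big_mkcond; apply: eq_bigr => i _; rewrite col_mxEu !mxE.
by case: ifP => _; rewrite ?mul1r ?mul0r.
Qed.

Lemma sum_row_vertex (x : 'I_n -> rat) (k : 'I_n) :
  \sum_i (functional_mx (rshift m k) i)%:~R * x i = x k.
Proof.
rewrite (bigD1 k) //= big1 ?addr0 => [|i ik]; rewrite col_mxEd mxE ?eqxx ?mul1r //.
by rewrite eq_sym (negPf ik) mul0r.
Qed.

(** The constraints used below bound either an edge sum x(E) or a single
    coordinate x_i, from either side. *)
Definition edge_or_vertex : Type := ({set 'I_n} + 'I_n)%type.

Definition is_row (r : edge_or_vertex) : bool :=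
  if r is inl E then E \in edges H else true.

Definition rowval (x : 'I_n -> rat) (r : edge_or_vertex) : rat :=
  match r with inl E => \sum_(i in E) x i | inr i => x i end.

Definition in_box (lo hi : edge_or_vertex -> option rat) (x : 'I_n -> rat) :=
  forall r, is_row r ->
    (forall a, lo r = Some a -> a <= rowval x r) /\
    (forall b, hi r = Some b -> rowval x r <= b).

(** A bounded program whose constraints are bounds on edge sums and coordinates
    has an optimal vertex that is an integral combination, with coefficients 0,
    1 and -1, of n bounds attained at it. *)
Lemma box_vertex (lo hi : edge_or_vertex -> option rat) (c x : 'I_n -> rat) :
  (forall y, (forall r, is_row r -> (hi r -> rowval y r <= 0) /\
                                    (lo r -> 0 <= rowval y r)) ->
   forall i, y i = 0) ->
  in_box lo hi x ->
  exists x' : 'I_n -> rat,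
    [/\ in_box lo hi x', \sum_i c i * x i <= \sum_i c i * x' i
      & exists (N : 'M[int]_n) (f : 'I_n -> edge_or_vertex),
          [/\ forall j, is_row (f j) /\
                Some (rowval x' (f j)) \in [:: hi (f j); lo (f j)],
              forall i j, `|N i j| <= 1
            & forall i, x' i = \sum_j (N i j)%:~R * rowval x' (f j)]].
Proof.
move=> bnd xbox.
pose lab (r : 'I_(m + n)) : edge_or_vertex :=
  match split r with inl j => inl (enum_val j) | inr k => inr k end.
have labP x0 r : \sum_i (functional_mx r i)%:~R * x0 i = rowval x0 (lab r).
  rewrite /lab; case: split_ordP => k ->; first exact: sum_row_edge.
  exact: sum_row_vertex.
have lab_row r : is_row (lab r).
  by rewrite /lab; case: split => //= k; apply: enum_valP.
have lab_sur r : is_row r -> exists r', r = lab r'.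
  case: r => [E /= EH|k _].
    exists (lshift n (enum_rank_in (EH : E \in edges H) E)); rewrite /lab.
    by rewrite (unsplitK (inl _)) enum_rankK_in.
  by exists (rshift m k); rewrite /lab (unsplitK (inr _)).
(* The boolean of the index distinguishes lower bounds (true), written with
   reversed sign, from upper bounds. *)
pose P (j : bool * 'I_(m + n)) : bool := if j.1 then lo (lab j.2) else hi (lab j.2).
pose W (j : bool * 'I_(m + n)) i : rat := (-1) ^+ j.1 * (functional_mx j.2 i)%:~R.
pose w (j : bool * 'I_(m + n)) : rat :=
  if j.1 then - odflt 0 (lo (lab j.2)) else odflt 0 (hi (lab j.2)).
have WE j y : \sum_i W j i * y i = (-1) ^+ j.1 * rowval y (lab j.2).
  by rewrite -labP mulr_sumr; apply: eq_bigr => i _; rewrite mulrA.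
have feasE y : (forall j, P j -> \sum_i W j i * y i <= w j) <-> in_box lo hi y.
  split=> [fy r|ybox [b r]]; last first.
    rewrite /P WE /w /=; have [lor hir] := ybox _ (lab_row r).
    case: b => /=; last by case: (hi _) hir => // b /(_ _ erefl); rewrite mul1r.
    by case: (lo _) lor => // b /(_ _ erefl); rewrite mulN1r lerN2.
  case/lab_sur=> {}r ->; split=> a ra.
    by have := fy (true, r); rewrite /P /w WE /= ra mulN1r lerN2; apply.
  by have := fy (false, r); rewrite /P /w WE /= ra mul1r; apply.
have [|//|x' [x'box x'obj x'basic]] := @polyhedron_vertex n _ P W w c x.
- move=> y yP; apply: bnd => r /lab_sur[{}r ->]; split=> hr.
    by have := yP (false, r) hr; rewrite WE mul1r.
  by have := yP (true, r) hr; rewrite WE mulN1r oppr_le0.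
- exact/feasE.
exists x'; split=> //; first exact/feasE.
pose T (r : 'I_(m + n)) := Some (rowval x' (lab r)) \in [:: hi (lab r); lo (lab r)].
have tuW : totally_unimodular functional_mx.
  exact/totally_unimodular_id/totally_unimodular_tr.
have [|N [f [Tf N1 NE]]] := @unimodular_basis _ _ functional_mx T tuW.
  move=> y yT; apply: x'basic => -[b r]; rewrite /P /w !WE /= => Pbr tbr.
  rewrite -labP yT ?mulr0 // /T !inE.
  case: b Pbr tbr => /=.
    by case: (lo _) => // a _; rewrite mulN1r => /oppr_inj ->; rewrite eqxx orbT.
  by case: (hi _) => // a _; rewrite mul1r => ->; rewrite eqxx.
exists N, (lab \o f); split=> [j|//|i]; first by split; [exact: lab_row|exact: Tf].
by rewrite (NE x' i); apply: eq_bigr => j _; rewrite labP.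
Qed.

(** Hoffman-Kruskal: take a vertex of the box cut out by the floors and
    ceilings of all the edge sums and coordinates of x. *)
Lemma unimodular_round (x : 'I_n -> rat) :
  exists z : 'I_n -> int,
    [/\ forall i (a : int), (a%:~R <= x i -> a <= z i) /\ (x i <= a%:~R -> z i <= a),
        forall E, E \in edges H -> forall a : int,
          (a%:~R <= \sum_(i in E) x i -> a <= \sum_(i in E) z i) /\
          (\sum_(i in E) x i <= a%:~R -> \sum_(i in E) z i <= a)
      & \sum_i x i <= (\sum_i z i)%:~R].
Proof.
pose lo r : option rat := Some (Num.floor (rowval x r))%:~R.
pose hi r : option rat := Some (Num.ceil (rowval x r))%:~R.
have [||x' [x'box obj [N [f [tight _ x'E]]]]] := @box_vertex lo hi (fun=> 1) x.
- move=> y yP i; have [] := yP (inr i) isT => /(_ isT) y1 /(_ isT) y2.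
  by apply/le_anti/andP.
- by move=> r _; split=> a [<-]; rewrite ?floor_le ?ceil_ge.
have [z zE] : exists z : 'I_n -> int, forall i, x' i = (z i)%:~R.
  have rint j : exists b : int, rowval x' (f j) = b%:~R.
    by have [_] := tight j; rewrite !inE => /orP[] /eqP[->]; eexists.
  exists (fun i => \sum_j N i j * Num.floor (rowval x' (f j))) => i.
  rewrite x'E rmorph_sum; apply: eq_bigr => j _; rewrite rmorphM /=.
  by have [b ->] := rint j; rewrite intrKfloor.
have sumz (A : {set 'I_n}) : \sum_(i in A) x' i = (\sum_(i in A) z i)%:~R.
  by rewrite rmorph_sum; apply: eq_bigr => i _; rewrite zE.
have keep r (k a : int) : is_row r -> rowval x' r = k%:~R ->
    (a%:~R <= rowval x r -> a <= k) /\ (rowval x r <= a%:~R -> k <= a).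
  move=> rr rk; have [l h] := x'box r rr; split=> ax; rewrite -(ler_int rat) -rk.
    by apply: le_trans (l _ erefl); rewrite ler_int floor_ge_int.
  by apply: le_trans (h _ erefl) _; rewrite ler_int ceil_le_int.
exists z; split=> [i a|E EH a|].
- exact: (keep (inr i) (z i) a isT (zE i)).
- exact: (keep (inl E) _ a EH (sumz E)).
have -> : (\sum_i z i)%:~R = \sum_i 1 * x' i.
  by rewrite rmorph_sum; apply: eq_bigr => i _; rewrite mul1r zE.
by under eq_bigr do rewrite -[x _]mul1r.
Qed.

(** The integer decomposition property: rounding a / (s + 1) gives z <= a with
    z(E) >= 1 and (a - z)(E) >= s, and the support of z is a cover.  It lets one
    split a cover off an exponent of order s + 1. *)
Lemma split_vertex_cover (s : int) (a : 'I_n -> int) :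
  0 <= s -> (forall i, 0 <= a i) ->
  (forall E, E \in edges H -> s + 1 <= \sum_(i in E) a i) ->
  exists T : {set 'I_n},
    [/\ vertex_cover H T, forall i, i \in T -> 1 <= a i
      & forall E, E \in edges H -> s <= \sum_(i in E) (a i - (i \in T)%:R)].
Proof.
move=> s0 a0 aE; have s1 : 0 < (s + 1)%:~R :> rat by rewrite ltr0z; lia.
have [z [zi zE _]] := unimodular_round (fun i => (a i)%:~R / (s + 1)%:~R).
have z0 i : 0 <= z i.
  by have [+ _] := zi i 0; apply; rewrite mulr0z divr_ge0 ?(ltW s1) // ler0z.
have za i : z i <= a i.
  have [_ +] := zi i (a i); apply; rewrite ler_pdivrMr // -intrM ler_int.
  by have := a0 i; nia.
have sumE (E : {set 'I_n}) : \sum_(i in E) (a i)%:~R / (s + 1)%:~R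
    = (\sum_(i in E) a i)%:~R / (s + 1)%:~R :> rat.
  by rewrite rmorph_sum mulr_suml.
exists [set i | 0 < z i]; split.
- apply/forall_inP => E EH; apply/set0Pn.
  have zE1 : 1 <= \sum_(i in E) z i.
    have [+ _] := zE E EH 1; apply; rewrite sumE ler_pdivlMr // mul1r ler_int.
    exact: aE.
  apply: NNPP => H0; suff : \sum_(i in E) z i <= 0 by lia.
  apply: sumr_le0 => i iE; rewrite leNgt; apply/negP => zi0.
  by apply: H0; exists i; rewrite !inE zi0 iE.
- by move=> i; rewrite inE => zi0; have := za i; lia.
move=> E EH; have zEs : \sum_(i in E) z i <= \sum_(i in E) a i - s.
  have [_ +] := zE E EH (\sum_(i in E) a i - s); apply.
  rewrite sumE ler_pdivrMr // -intrM ler_int.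
  by have := aE E EH; nia.
have : \sum_(i in E) (i \in [set i | 0 < z i])%:R <= \sum_(i in E) z i :> int.
  apply: ler_sum => i _; rewrite inE; have := z0 i.
  by case: ltP => //=; lia.
rewrite sumrB => Tz; rewrite lerBrDl -lerBrDr.
by apply: le_trans Tz zEs.
Qed.
End Polytopes.

Lemma int_ex_max (P : int -> Prop) (b : int) :
  (exists k, P k) -> (forall k, P k -> k <= b) ->
  exists k, P k /\ forall k', P k' -> k' <= k.
Proof.
move=> [k0 Pk0] Pb; have [N] := ubnP `|b - k0|%N; elim: N k0 Pk0 => // N IH k Pk kN.
case: (classic (forall k', P k' -> k' <= k)) => [|nmax]; first by exists k.
have [k' [Pk' kk']] : exists k', P k' /\ k < k'.
  apply: NNPP => H; apply: nmax => k' Pk'; rewrite leNgt; apply/negP => kk'.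
  by apply: H; exists k'.
by apply: (IH k') => //; have := Pb _ Pk'; have := Pb _ Pk; lia.
Qed.

(** * Growth of the maximal degree in a region *)

Section Growth.
Variables (n : nat) (H : hypergraph n).
Hypothesis HU : unimodular H.
Variables (G : {set 'I_n}) (B : {set {set 'I_n}}).
Hypothesis BH : forall E, E \in B -> E \in edges H /\ [disjoint E & G].
Hypothesis Bcover : forall i, i \notin G -> exists2 E, E \in B & i \in E.
Hypothesis B0 : exists E, E \in B.

(** Three programs share this shape.  With (g, h, l) = (-1, s - 1, s) the
    region contains the exponents of negative support G for which B is the set
    of edges with sum below s, normalized to -1 on G; with (0, 1, 1) it is the
    limit program, which contains their slopes. *)
Definition in_region (R : numDomainType) (g h l : R) (x : 'I_n -> R) :=
  [/\ forall i, i \in G -> x i = g, forall i, i \notin G -> 0 <= x i,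
      forall E, E \in B -> \sum_(i in E) x i <= h
    & forall E, E \in edges H -> [disjoint E & G] -> E \notin B ->
        l <= \sum_(i in E) x i].

Lemma disjoint_notin (E : {set 'I_n}) i : [disjoint E & G] -> i \in E -> i \notin G.
Proof. by move=> dEG iE; rewrite (disjointFr dEG iE). Qed.

Lemma region_le (R : numDomainType) (g h l : R) x i :
  in_region g h l x -> i \notin G -> x i <= h.
Proof.
move=> [_ x0 xB _] iG; have [E EB iE] := Bcover iG.
apply: le_trans (xB E EB); rewrite (bigD1 i) //= lerDl sumr_ge0 // => k.
move=> /andP[kE _]; apply: x0; have [_ dEG] := BH EB.
exact: disjoint_notin dEG kE.
Qed.

Lemma region_sum_le (R : numDomainType) (g h l : R) x :
  in_region g h l x -> \sum_i x i <= \sum_i (if i \in G then g else h).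
Proof.
move=> xP; apply: ler_sum => i _; case: ifP => [iG|/negbT iG].
  by have [-> //] := xP.
exact: region_le xP iG.
Qed.

Lemma region_round (g h l : int) (x : 'I_n -> rat) :
  in_region g%:~R h%:~R l%:~R x ->
  exists z : 'I_n -> int, in_region g h l z /\ \sum_i x i <= (\sum_i z i)%:~R.
Proof.
move=> [xg x0 xB xC]; have [z [zi zE zs]] := unimodular_round HU x.
exists z; split=> //; split.
- move=> i iG; have [zl zh] := zi i g.
  by apply/le_anti/andP; split; [apply: zh|apply: zl]; rewrite xg.
- by move=> i iG; have [+ _] := zi i 0; apply; rewrite mulr0z; apply: x0.
- by move=> E EB; have [EH _] := BH EB; have [_ +] := zE E EH h; apply; apply: xB.
- by move=> E EH dEG EB; have [+ _] := zE E EH l; apply; apply: xC.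
Qed.

(** Rescaling points of a region makes them feasible for the limit program:
    k = s serves to show that this program is feasible at all, and the sharper
    k = s - 1 to show d <= e. *)
Lemma region_rescale (s k : int) (a : 'I_n -> int) :
  0 < k -> s - 1 <= k -> k <= s -> in_region (-1) (s - 1) s a ->
  in_region 0%:~R 1%:~R 1%:~R (fun i => (a i + (i \in G)%:R)%:~R / k%:~R : rat).
Proof.
move=> k0 sk ks [aG a0 aB aC]; have k0' : 0 < k%:~R :> rat by rewrite ltr0z.
have sumE (E : {set 'I_n}) : [disjoint E & G] ->
    \sum_(i in E) (a i + (i \in G)%:R)%:~R / k%:~R
    = (\sum_(i in E) a i)%:~R / k%:~R :> rat.
  move=> dEG; rewrite rmorph_sum mulr_suml; apply: eq_bigr => i iE.
  by rewrite (negPf (disjoint_notin dEG iE)) addr0.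
split=> [i iG|i iG|E EB|E EH dEG EB].
- by rewrite aG // iG addNr mul0r.
- by rewrite divr_ge0 ?ler0z ?(ltW k0) // (negPf iG) addr0 a0.
- have [EH dEG] := BH EB.
  rewrite sumE // ler_pdivrMr // mul1r ler_int; exact: le_trans (aB E EB) _.
- by rewrite sumE // ler_pdivlMr // mul1r ler_int; apply: le_trans (aC E _ _ _).
Qed.

Lemma G_lt : (#|G| < n)%N.
Proof.
have [E EB] := B0; have [EH dEG] := BH EB.
have /set0Pn[i iE] : E != set0.
  by apply: contraNneq (edges_nonempty H) => <-.
rewrite -[X in (_ < X)%N](card_ord n) -cardsT; apply: proper_card.
rewrite properE subsetT; apply/subsetPn; exists i; rewrite ?inE //.
exact: disjoint_notin dEG iE.
Qed.

(** At a vertex every tight constraint has a value (s + 1) p - q with p and q in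
    {0, 1}, so that a' = (s + 1) u - v where u and v are images of the vectors
    p and q under the same matrix N.  If G is empty, then |q - p| <= 1 - q for
    each tight constraint, so that |v_i| and |v_i - u_i| add up to at most n;
    this yields the last clause. *)
Lemma region_vertex (s : nat) (a : 'I_n -> int) :
  (n ^ 2 <= s)%N -> in_region (-1) (s%:Z + 1 - 1) (s%:Z + 1) a ->
  exists u v : 'I_n -> int,
    let a' i := (s%:Z + 1) * u i - v i in
    [/\ in_region (-1) (s%:Z + 1 - 1) (s%:Z + 1) a', \sum_i a i <= \sum_i a' i,
        forall i, `|v i| <= n%:Z
      & G = set0 -> forall i, u i = 0 -> `|v i| *+ 2 <= n%:Z].
Proof.
move=> ns [aG a0 aB aC].
pose lo (r : edge_or_vertex n) : option rat := match r with
  | inl E => if (E \in B) || ~~ [disjoint E & G] then None else Some (s%:Z + 1)%:~R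
  | inr i => Some (if i \in G then -1 else 0) end.
pose hi (r : edge_or_vertex n) : option rat := match r with
  | inl E => if E \in B then Some s%:~R else None
  | inr i => if i \in G then Some (-1) else None end.
pose p (r : edge_or_vertex n) : int := if r is inl _ then 1 else 0.
pose q (r : edge_or_vertex n) : int :=
  match r with inl E => (E \in B)%:R | inr i => (i \in G)%:R end.
have [||x [xbox obj [N [f [tight N1 xE]]]]] :=
    @box_vertex n H HU lo hi (fun=> 1) (fun i => (a i)%:~R).
- move=> y yP.
  have yi0 i : 0 <= y i by have [_] := yP (inr i) isT => /(_ isT).
  move=> i; apply/le_anti; rewrite yi0 andbT.
  have [iG|iG] := boolP (i \in G).
    by have [+ _] := yP (inr i) isT; rewrite /hi /= iG; apply.
  have [E EB iE] := Bcover iG; have [EH _] := BH EB.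
  have [+ _] := yP (inl E) EH; rewrite /hi /= EB => /(_ isT).
  apply: le_trans; rewrite (bigD1 i) //= lerDl; exact: sumr_ge0.
- have sumE (E : {set 'I_n}) : \sum_(i in E) (a i)%:~R = (\sum_(i in E) a i)%:~R :> rat.
    by rewrite rmorph_sum.
  case=> [E EH|i _]; split=> b; rewrite /lo /hi /=.
  + by case: ifP => // /norP[EB /negPn dEG] [<-]; rewrite sumE ler_int; apply: aC.
  + by case: ifP => // EB [<-]; rewrite sumE ler_int -[s%:Z](addrK 1); exact: aB.
  + case: ifPn => iG [<-]; first by rewrite aG.
    by rewrite ler0z a0.
  + by case: ifP => // iG [<-]; rewrite aG.
have fval j : rowval x (f j) = ((s%:Z + 1) * p (f j) - q (f j))%:~R.
  have [_] := tight j; rewrite !inE => /orP[] /eqP; case: (f j) => [E|i];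
    rewrite /hi /lo /p /q /=.
  - by case: (E \in B) => // -[->]; congr (_%:~R); lia.
  - by case: (i \in G) => // -[->]; rewrite mulr0.
  - case: (E \in B) => //=; case: [disjoint _ & _] => //= -[->].
    by congr (_%:~R); lia.
  - by case: (i \in G) => -[->]; rewrite mulr0.
pose u i := \sum_j N i j * p (f j); pose v i := \sum_j N i j * q (f j).
exists u, v; pose a' i := (s%:Z + 1) * u i - v i.
have xa' i : x i = (a' i)%:~R.
  rewrite xE /a' /u /v mulr_sumr -sumrB rmorph_sum; apply: eq_bigr => j _.
  by rewrite fval -intrM; congr (_%:~R); ring.
have sumE (E : {set 'I_n}) : \sum_(i in E) x i = (\sum_(i in E) a' i)%:~R :> rat.
  by rewrite rmorph_sum; apply: eq_bigr => i _; rewrite xa'.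
have q01 r : 0 <= q r <= 1 by case: r => k; rewrite /q; case: (_ \in _).
have vb i : `|v i| <= \sum_j q (f j).
  apply: le_trans (ler_norm_sum _ _ _) _; apply: ler_sum => j _.
  rewrite normrM; have := N1 i j; have := q01 (f j); move: (q _) (N i j) => b c.
  by nia.
split=> /=; rewrite -/a'.
- split=> [i iG|i iG|E EB|E EH dEG EB].
  + have [l h] := xbox (inr i) isT.
    have := l _ erefl; rewrite iG /= xa' => l'.
    have := h (-1); rewrite /= iG xa' => /(_ erefl) h'.
    by rewrite -(rmorphN1 intr) !ler_int in l' h'; lia.
  + have [l _] := xbox (inr i) isT; have := l _ erefl.
    by rewrite (negPf iG) /= xa' ler0z.
  + have [EH _] := BH EB; have [_ h] := xbox (inl E) EH.
    by have := h s%:~R; rewrite /= EB => /(_ erefl); rewrite sumE ler_int addrK.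
  + have [l _] := xbox (inl E) EH; rewrite -(ler_int rat) -sumE.
    by apply: l; rewrite /= (negPf EB) dEG.
- rewrite -(ler_int rat) !rmorph_sum /=.
  have -> : \sum_i (a' i)%:~R = \sum_i 1 * x i.
    by apply: eq_bigr => i _; rewrite mul1r xa'.
  by under eq_bigr do rewrite -[_%:~R]mul1r.
- move=> i; apply: le_trans (vb i) _.
  have -> : n%:Z = \sum_(j < n) 1 by rewrite sumr_const card_ord -natz.
  by apply: ler_sum => j _; case/andP: (q01 (f j)).
move=> G0 i ui0.
have vub : `|v i - u i| <= \sum_j (1 - q (f j)).
  rewrite -sumrB; apply: le_trans (ler_norm_sum _ _ _) _; apply: ler_sum => j _.
  rewrite -mulrBr normrM; have := N1 i j; have := q01 (f j).
  have : `|q (f j) - p (f j)| <= 1 - q (f j).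
    by case: (f j) => k; rewrite /q /p ?G0 ?inE //; case: (k \in _).
  by move: (q (f j) - p (f j)) (q (f j)) (N i j) => b c d; nia.
have : \sum_(j < n) (1 - q (f j)) = n%:Z - \sum_j q (f j).
  by rewrite sumrB sumr_const card_ord -[in RHS]natz.
move=> sumq; move: (vb i) vub; rewrite ui0 subr0 sumq mulr2n.
by move: (\sum_j q (f j)) => c; lia.
Qed.

(** Subtracting the slope leads from s + 1 to s.  The bound |v(E)| <= n^2 <= s
    confines u(E) to the right values.  The delicate case is E in B with
    u(E) = 0, where a(E) = - v(E) must be at most s - 1 and not just s: if G is
    empty the halved bound on v_i suffices, and otherwise E has at most n - 1
    elements. *)
Lemma region_descend (s : nat) (u v : 'I_n -> int) :
  (n ^ 2 <= s)%N ->
  in_region (-1) (s%:Z + 1 - 1) (s%:Z + 1) (fun i => (s%:Z + 1) * u i - v i) ->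
  (forall i, `|v i| <= n%:Z) ->
  (G = set0 -> forall i, u i = 0 -> `|v i| *+ 2 <= n%:Z) ->
  in_region 0 1 1 u /\
  in_region (-1) (s%:Z - 1) s%:Z (fun i => s%:Z * u i - v i).
Proof.
move=> ns [aG a0 aB aC] vn v2.
have Gn := G_lt.
have n0 : (0 < n)%N by apply: leq_ltn_trans Gn.
have ns' : n%:Z * n%:Z <= s%:Z by rewrite -PoszM lez_nat mulnn.
have nles : n%:Z <= s%:Z by nia.
have vi i : - n%:Z <= v i <= n%:Z by rewrite -ler_norml vn.
have uG i : i \in G -> u i = 0.
  move=> iG; have n2 : (1 < n)%N.
    by apply: leq_ltn_trans Gn; rewrite card_gt0; apply/set0Pn; exists i.
  by have := aG i iG; have := vi i; move: (u i) (v i) => x y; nia.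
have u0 i : i \notin G -> 0 <= u i.
  move=> iG; have := a0 i iG; have := vi i; move: (u i) (v i) => x y.
  by move=> /andP[] *; rewrite leNgt; apply/negP => ?; nia.
have sumb (w : 'I_n -> int) (E : {set 'I_n}) :
    (forall i, i \in E -> `|w i| <= n%:Z) -> `|\sum_(i in E) w i| <= #|E|%:Z * n%:Z.
  move=> wE; apply: le_trans (ler_norm_sum _ _ _) _.
  have -> : #|E|%:Z * n%:Z = \sum_(i in E) n%:Z.
    by rewrite sumr_const -mulr_natl natz.
  by apply: ler_sum => i iE; apply: wE.
have sumv (E : {set 'I_n}) : `|\sum_(i in E) v i| <= #|E|%:Z * n%:Z.
  exact: sumb.
have cardE (E : {set 'I_n}) : #|E|%:Z <= n%:Z.
  by rewrite lez_nat -[n in (_ <= n)%N]card_ord max_card.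
have sumE (b : int) (E : {set 'I_n}) : \sum_(i in E) (b * u i - v i)
    = b * (\sum_(i in E) u i) - \sum_(i in E) v i.
  by rewrite sumrB mulr_sumr.
have sumuE (E : {set 'I_n}) : [disjoint E & G] -> 0 <= \sum_(i in E) u i.
  by move=> dEG; apply: sumr_ge0 => i iE; apply: u0; apply: disjoint_notin dEG iE.
split; split.
- exact: uG.
- exact: u0.
- move=> E EB; have := aB E EB; rewrite sumE; have := sumv E; have := cardE E.
  move: (\sum_(i in E) u i) (\sum_(i in E) v i) (#|E|%:Z) => x y z.
  by move=> zn yz xy; rewrite leNgt; apply/negP => x1; nia.
- move=> E EH dEG EB; have := aC E EH dEG EB; rewrite sumE.
  have := sumv E; have := cardE E.
  move: (\sum_(i in E) u i) (\sum_(i in E) v i) (#|E|%:Z) => x y z.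
  by move=> zn yz xy; rewrite leNgt; apply/negP => x1; nia.
- by move=> i iG; have := aG i iG; rewrite uG // !mulr0.
- move=> i iG; have := a0 i iG; have := u0 i iG; have := vi i.
  move: (u i) (v i) => x y; have [->|x0] := eqVneq x 0; first by rewrite !mulr0.
  by move=> *; nia.
- move=> E EB; have [EH dEG] := BH EB.
  have := aB E EB; rewrite !sumE; have := sumv E; have := cardE E.
  have := sumuE E dEG.
  have [xE0|xE0] := eqVneq (\sum_(i in E) u i) 0; last first.
    move: (\sum_(i in E) u i) xE0 (\sum_(i in E) v i) (#|E|%:Z) => x x0 y z.
    by move=> *; nia.
  have ui0 i : i \in E -> u i = 0.
    move=> iE; apply/le_anti; rewrite u0 ?(disjoint_notin dEG) // andbT -xE0.
    rewrite (bigD1 i) //= lerDl sumr_ge0 // => k /andP[kE _].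
    by rewrite u0 // (disjoint_notin dEG).
  rewrite xE0 !mulr0 !sub0r => _ En vE _.
  have [G0|Gn0] := eqVneq G set0.
    have := @sumb (fun i => v i *+ 2) E; rewrite sumrMnl => sumv2.
    have {}sumv2 : `|(\sum_(i in E) v i) *+ 2| <= #|E|%:Z * n%:Z.
      by apply: sumv2 => i iE; rewrite normrMn; apply: v2 => //; apply: ui0.
    move: sumv2 En; rewrite mulr2n; move: (\sum_(i in E) v i) (#|E|%:Z) => y z.
    by move=> *; nia.
  have {}En : #|E|%:Z <= n%:Z - 1.
    have : (#|E| + #|G| <= n)%N.
      rewrite -cardsUI disjoint_setI0 // cards0 addn0.
      by rewrite -[n in (_ <= n)%N]card_ord max_card.
    by move: Gn0; rewrite -card_gt0; lia.
  move: vE En; move: (\sum_(i in E) v i) (#|E|%:Z) => y z.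
  by move=> *; nia.
- move=> E EH dEG EB; have := aC E EH dEG EB; rewrite !sumE.
  have := sumv E; have := cardE E; have := sumuE E dEG.
  move: (\sum_(i in E) u i) (\sum_(i in E) v i) (#|E|%:Z) => x y z.
  move=> x0 zn yz xy; have x1 : 1 <= x by rewrite leNgt; apply/negP => x1; nia.
  have ys : `|y| <= s%:Z by nia.
  have [x1'|xn1] := eqVneq x 1; first by move: xy; rewrite x1' !mulr1; lia.
  have : s%:Z * 2 <= s%:Z * x by rewrite ler_wpM2l //; lia.
  by lia.
Qed.

Lemma region_max (g h l : int) (x0 : 'I_n -> int) :
  in_region g h l x0 ->
  exists x, in_region g h l x /\
    forall y, in_region g h l y -> \sum_i y i <= \sum_i x i.
Proof.
move=> x0P.
have [||k [[x [xP <-]] xmax]] := @int_ex_max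
    (fun k => exists x, in_region g h l x /\ \sum_i x i = k)
    (\sum_i (if i \in G then g else h)).
- by exists (\sum_i x0 i), x0.
- by move=> k [x [xP <-]]; apply: region_sum_le xP.
by exists x; split=> // y yP; apply: xmax; exists y.
Qed.

(** With f(s) the largest total degree in the region, [descend] gives
    f(s + 1) <= f(s) + d and [slab_add] gives the converse; feasibility
    propagates upwards by [slab_add] and downwards by [descend]. *)
Lemma region_growth :
  (exists (s : nat) (a : 'I_n -> int), (0 < s)%N /\ in_region (-1) (s%:Z - 1) s%:Z a) ->
  exists d e : nat, [/\ (0 < d)%N, (d <= e)%N, (e <= n ^ 2)%N &
    forall s, (n ^ 2 <= s)%N ->
      (exists a : 'I_n -> int, in_region (-1) (s%:Z - 1) s%:Z a /\
          \sum_i a i = (d * s)%:Z - e%:Z) /\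
      (forall a : 'I_n -> int, in_region (-1) (s%:Z - 1) s%:Z a ->
          \sum_i a i <= (d * s)%:Z - e%:Z)].
Proof.
pose slab (s : nat) := in_region (-1) (s%:Z - 1) s%:Z.
pose slope := in_region (0 : int) 1 1.
move=> [s0 [a0 [s0_gt0 a0P]]]; rewrite -/(slab s0 a0) in a0P.
have n0 : (0 < n)%N by apply: leq_ltn_trans G_lt.
have n20 : (0 < n ^ 2)%N by rewrite expn_gt0 n0.
have slab_add s a u : slab s a -> slope u -> slab s.+1 (fun i => a i + u i).
  move=> [aG a_ge0 aB aC] [uG u_ge0 uB uC]; rewrite /slab -addn1 PoszD.
  split=> [i iG|i iG|E EB|E EH dEG EB].
  - by rewrite aG // uG // addr0.
  - by rewrite addr_ge0 ?a_ge0 ?u_ge0.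
  - by rewrite big_split /= addrAC lerD ?aB ?uB.
  - by rewrite big_split /= lerD ?aC ?uC.
have slope_of s a k : slab s a -> (0 < k)%N -> s%:Z - 1 <= k%:Z -> k%:Z <= s%:Z ->
    exists2 u, slope u & \sum_i a i <= k%:Z * \sum_i u i.
  move=> aP k0 sk ks; have k0' : 0 < k%:Z by [].
  have [u [uP us]] := region_round (region_rescale k0' sk ks aP).
  exists u => //; rewrite -(ler_int rat) intrM; apply: (@le_trans _ _
    (k%:~R * \sum_i (a i + (i \in G)%:R)%:~R / k%:~R)).
    rewrite -mulr_suml mulrC divfK ?intr_eq0 -?lt0n // -rmorph_sum ler_int.
    by apply: ler_sum => i _; rewrite lerDl; case: (_ \in _).
  by rewrite ler_wpM2l // ler0z.
have [u0 u0P _] : exists2 u, slope u & \sum_i a0 i <= s0%:Z * \sum_i u i.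
  by apply: (slope_of s0 a0 s0) => //; lia.
have [ud [udP dmax]] := region_max u0P.
pose d := \sum_i ud i; rewrite -/d in dmax.
(* If d = 0 then 0 is the only slope, hence there is no lower edge constraint;
   but then every unit vector off G is a slope. *)
have d1 : 1 <= d.
  rewrite leNgt; apply/negP => d0; have [udG ud_ge0 udB udC] := udP.
  have ud0 i : 0 <= ud i.
    by have [/udG->|/ud_ge0] := boolP (i \in G).
  have noC E : E \in edges H -> [disjoint E & G] -> E \notin B -> False.
    move=> EH dEG EB; have := udC E EH dEG EB.
    suff : \sum_(i in E) ud i <= d by lia.
    rewrite /d [X in _ <= X](bigID (mem E)) /= lerDl; exact: sumr_ge0.
  have [E EB] := B0; have [EH dEG] := BH EB.
  have /set0Pn[i iE] : E != set0.
    by apply: contraNneq (edges_nonempty H) => <-.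
  suff /dmax : slope (fun k => (k == i)%:R).
    by rewrite (bigD1 i) //= big1 ?addr0 ?eqxx => [|k /negPf->] //; lia.
  split=> [k kG|k _|E' _|E' E'H dE'G E'B]; last by case: (noC E').
  - by case: eqP => // ki; move: kG; rewrite ki (negPf (disjoint_notin dEG iE)).
  - by case: eqP.
  - have [iE'|iE'] := boolP (i \in E').
      by rewrite (bigD1 i) //= eqxx big1 ?addr0 // => k /andP[_ /negPf->].
    rewrite big1 // => k kE'; case: eqP => // ki.
    by rewrite -ki kE' in iE'.
have descend s a : (n ^ 2 <= s)%N -> slab s.+1 a ->
    exists u v b : 'I_n -> int, [/\ slope u, slab s b,
      \sum_i a i <= \sum_i b i + \sum_i u i,
      \sum_i b i = s%:Z * (\sum_i u i) - \sum_i v i & forall i, `|v i| <= n%:Z].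
  move=> ns; rewrite /slab -addn1 PoszD => aP.
  have [u [v [a'P aa' vn v2]]] := region_vertex ns aP.
  have [uP bP] := region_descend ns a'P vn v2.
  exists u, v, (fun i => s%:Z * u i - v i); split=> //.
    apply: le_trans aa' _; rewrite -big_split /=; apply: ler_sum => i _.
    by rewrite mulrDl mul1r addrAC.
  by rewrite sumrB mulr_sumr.
have ne_up k : exists a, slab (s0 + k)%N a.
  elim: k => [|k [a aP]]; first by exists a0; rewrite addn0.
  by exists (fun i => a i + u0 i); rewrite addnS; apply: slab_add.
have ne s : (n ^ 2 <= s)%N -> exists a, slab s a.
  move=> ns; have := ne_up s; rewrite addnC.
  elim: {ne_up a0P s0_gt0} s0 => [|k IH]; rewrite ?addn0 //.
  rewrite addnS => -[a aP]; apply: IH.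
  have [|u [v [b [_ bP _ _ _]]]] := descend _ a _ aP; last by exists b.
  by rewrite (leq_trans ns) // leq_addr.
pose ismax s k := (exists2 a, slab s a & \sum_i a i = k) /\
                  (forall a, slab s a -> \sum_i a i <= k).
have max_ex s : (n ^ 2 <= s)%N -> exists k, ismax s k.
  move=> ns; have [a aP] := ne s ns.
  have [b [bP bmax]] := region_max aP.
  by exists (\sum_i b i); split=> //; exists b.
have max_step s k : (n ^ 2 <= s)%N -> ismax s k -> ismax s.+1 (k + d).
  move=> ns [[a aP ak] kmax]; split.
    exists (fun i => a i + ud i); first exact: slab_add.
    by rewrite big_split /= ak.
  move=> b /(descend _ _ ns)[u [v [c [uP cP bc _ _]]]].
  by apply: le_trans bc _; rewrite lerD ?kmax ?dmax.
have [f0 f0max] := max_ex _ (leqnn _).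
pose e := d * (n ^ 2)%N%:Z - f0.
have fmax k : ismax (n ^ 2 + k)%N (d * (n ^ 2 + k)%N%:Z - e).
  elim: k => [|k IH]; first by rewrite addn0 /e opprB addrC subrK.
  rewrite addnS -addn1 PoszD mulrDr mulr1 addrAC addn1; apply: max_step => //.
  exact: leq_addr.
have [[a1 a1P a1E] _] := fmax 1%N.
(* Equality in f (n ^ 2 + 1) = f (n ^ 2) + d forces the slope u of the optimal
   vertex to have degree d, so that e is the degree of v. *)
have en : e <= n%:Z * n%:Z.
  move: (a1P); rewrite addn1 => /(descend _ _ (leqnn _))[u [v [b [uP bP a1b bE vn]]]].
  have := dmax u uP; have [_ /(_ b bP)] := f0max.
  have : \sum_i v i <= n%:Z * n%:Z.
    apply: (@le_trans _ _ (\sum_(i < n) n%:Z)).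
      by apply: ler_sum => i _; apply: le_trans (ler_norm _) (vn i).
    by rewrite sumr_const card_ord -mulr_natl natz.
  move: a1b bE; rewrite a1E /e PoszD mulrDr mulr1.
  move: (\sum_i u i) (\sum_i v i) (\sum_i b i) ((n ^ 2)%N%:Z) => x y z N.
  move=> h1 h2 h3 h4 h5; have xd : x = d by lia.
  by rewrite h2 xd in h1; lia.
have de : d <= e.
  have [|||u uP us] := slope_of _ _ (n ^ 2)%N a1P => //; [lia|lia|].
  have := dmax u uP; move: us; rewrite a1E PoszD mulrDr mulr1 => us ud'.
  have := ler_wpM2l (ltW (n20 : 0 < (n ^ 2)%N%:Z)) ud'.
  by rewrite mulrC; lia.
exists `|d|%N, `|e|%N.
have dE : `|d|%N%:Z = d by rewrite gez0_abs //; lia.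
have eE : `|e|%N%:Z = e by rewrite gez0_abs //; lia.
split; [lia|lia| |].
  by rewrite -lez_nat eE -mulnn PoszM.
move=> s ns; have [[a aP aE] smax] := fmax (s - n ^ 2)%N.
rewrite subnKC // in aP aE smax.
by rewrite PoszM dE eE; split=> //; exists a.
Qed.

End Growth.

(** * Laurent coefficients *)

Section Laurent.
Variables (n : nat) (K : fieldType).
Local Notation R := {mpoly K[n]}.
Local Notation F := {fraction R}.
Local Notation expo := {ffun 'I_n -> int}.

Implicit Types (S : {set 'I_n}) (a b : expo) (c : F) (p : R) (m : 'X_{1..n}).

Definition lmon a : F := \prod_i (tofrac 'X_i) ^ (a i).

Definition lconst (x : K) : F := tofrac x%:MP.

Lemma lconst0 : lconst 0 = 0.
Proof. by rewrite /lconst mpolyC0 tofrac0. Qed.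

Lemma lconst_sign k : (-1) ^+ k = lconst ((-1) ^+ k).
Proof. by rewrite /lconst rmorphXn rmorphN1 rmorphXn rmorphN1. Qed.

Lemma tofrac_mpolyX m : tofrac 'X_[m] = \prod_i (tofrac 'X_i : F) ^+ m i.
Proof.
by rewrite mpolyXE_id rmorph_prod; apply: eq_bigr => i _; rewrite rmorphXn.
Qed.

Lemma tofrac_var_neq0 i : (tofrac 'X_i : F) != 0.
Proof. by rewrite tofrac_eq0 -msupp_eq0 msuppX. Qed.

Lemma xprodX S k : @xprod n K S ^+ k = 'X_[[multinom (k * (i \in S))%N | i < n]].
Proof.
rewrite /xprod -prodrXl mpolyXE_id [LHS]big_mkcond; apply: eq_bigr => i _.
by rewrite mnmE; case: (i \in S); rewrite ?muln1 ?muln0 ?expr0.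
Qed.

Lemma xprod_neq0 S k : (tofrac (@xprod n K S) : F) ^+ k != 0.
Proof. by rewrite -rmorphXn /= xprodX tofrac_eq0 -msupp_eq0 msuppX. Qed.

Lemma frac_mpolyX S k m a :
  (forall i, (m i)%:Z = a i + (k * (i \in S))%:Z) ->
  tofrac 'X_[m] / tofrac (@xprod n K S) ^+ k = lmon a.
Proof.
move=> ma; apply: (canLR (mulfK (xprod_neq0 S k))).
rewrite -rmorphXn /= xprodX !tofrac_mpolyX -big_split; apply: eq_bigr => i _ /=.
by rewrite mnmE !exprnP ma -expfzDr // tofrac_var_neq0.
Qed.

Definition fexp S k m : expo := [ffun i => (m i)%:Z - (k * (i \in S))%:Z].

Lemma frac_expand S k p :
  tofrac p / tofrac (@xprod n K S) ^+ k
  = \sum_(m <- msupp p) lconst p@_m * lmon (fexp S k m).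
Proof.
rewrite {1}[p]mpolyE rmorph_sum mulr_suml; apply: eq_bigr => m _.
rewrite -mul_mpolyC /= tofracM -mulrA; congr (_ * _); apply: frac_mpolyX => i.
by rewrite ffunE subrK.
Qed.

(** Fractions whose denominator is a power of x_1 ... x_n: all the localizations
    in the Cech complex lie among them. *)
Definition laurent c :=
  exists (p : R) (k : nat), c = tofrac p / tofrac (@xprod n K setT) ^+ k.

Definition shift_coef p (k : nat) a : K :=
  if [forall i, 0 <= a i + k%:Z]
  then p@_[multinom absz (a i + k%:Z)%R | i < n] else 0.

Lemma shift_coefM p k k' a :
  shift_coef (p * @xprod n K setT ^+ k') (k + k') a = shift_coef p k a.
Proof.
rewrite /shift_coef xprodX; have [/forallP ak|nak] := boolP [forall i, 0 <= a i + k%:Z].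
  have -> : [forall i, 0 <= a i + (k + k')%:Z].
    by apply/forallP => i; have := ak i; lia.
  rewrite -[RHS](mcoeffMX _ [multinom (k' * (i \in [set: 'I_n]))%N | i < n]).
  congr (_@__); apply/mnmP => i; rewrite mnmDE !mnmE inE; have := ak i; lia.
case: ifP => // /forallP ak'; apply/eqP; rewrite mcoeff_eq0.
apply: contra nak; rewrite (perm_mem (msuppMX _ _)) => /mapP[m _ mE].
apply/forallP => i; move/mnmP/(_ i): mE; rewrite mnmDE !mnmE inE.
by have := ak' i; lia.
Qed.

(** The coefficient of x^a, read off a chosen representation p / x^k.  It does
    not depend on the choice ([lcoefE]), and its value is arbitrary outside
    [laurent]. *)
Definition lcoef a c : K :=
  let r := epsilon (inhabits (0 : R, 0%N))
    (fun r => c = tofrac r.1 / tofrac (@xprod n K setT) ^+ r.2) in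
  shift_coef r.1 r.2 a.

Lemma lcoefE p k a :
  lcoef a (tofrac p / tofrac (@xprod n K setT) ^+ k) = shift_coef p k a.
Proof.
rewrite /lcoef; set P := fun _ => _; have : exists r, P r by exists (p, k).
move/(epsilon_spec (inhabits (0 : R, 0%N))); move: (epsilon _ _) => [p' k'] /=.
rewrite /P /= => /eqP; rewrite eqr_div ?xprod_neq0 //.
rewrite -!rmorphXn -!rmorphM /= tofrac_eq => /eqP E.
by rewrite -(shift_coefM _ k' k) -E addnC shift_coefM.
Qed.

Lemma frac_addE S p k p' k' :
  tofrac p / tofrac (@xprod n K S) ^+ k + tofrac p' / tofrac (@xprod n K S) ^+ k'
  = tofrac (p * xprod K S ^+ k' + p' * xprod K S ^+ k)
      / tofrac (@xprod n K S) ^+ (k + k') :> F.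
Proof. by rewrite addf_div ?xprod_neq0 // exprD tofracD !tofracM !tofracXn. Qed.

Lemma laurentD c c' : laurent c -> laurent c' -> laurent (c + c').
Proof.
move=> [p [k ->]] [p' [k' ->]]; rewrite frac_addE.
by exists (p * xprod K setT ^+ k' + p' * xprod K setT ^+ k), (k + k')%N.
Qed.

Lemma laurent0 : laurent 0.
Proof. by exists 0, 0%N; rewrite tofrac0 mul0r. Qed.

Lemma laurentZ x c : laurent c -> laurent (lconst x * c).
Proof. by move=> [p [k ->]]; exists (x%:MP * p), k; rewrite rmorphM mulrA. Qed.

Lemma laurent_sum I (r : seq I) (P : pred I) (f : I -> F) :
  (forall i, P i -> laurent (f i)) -> laurent (\sum_(i <- r | P i) f i).
Proof. by move=> fP; apply: big_ind => //; [exact: laurent0|exact: laurentD]. Qed.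

Lemma lcoefD a c c' : laurent c -> laurent c' ->
  lcoef a (c + c') = lcoef a c + lcoef a c'.
Proof.
move=> [p [k ->]] [p' [k' ->]]; rewrite frac_addE !lcoefE.
rewrite -(shift_coefM p k k') -(shift_coefM p' k' k) [in RHS](addnC k').
rewrite /shift_coef; case: ifP => _; last by rewrite addr0.
by rewrite mcoeffD.
Qed.

Lemma lcoef0 a : lcoef a 0 = 0.
Proof.
have -> : 0 = tofrac 0 / tofrac (@xprod n K setT) ^+ 0 by rewrite tofrac0 mul0r.
by rewrite lcoefE /shift_coef mcoeff0 if_same.
Qed.

Lemma lcoefZ a x c : laurent c -> lcoef a (lconst x * c) = x * lcoef a c.
Proof.
move=> [p [k ->]]; rewrite mulrA -rmorphM !lcoefE /shift_coef mcoeffCM.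
by case: ifP; rewrite ?mulr0.
Qed.

Lemma lcoef_sum a I (r : seq I) (P : pred I) (f : I -> F) :
  (forall i, P i -> laurent (f i)) ->
  lcoef a (\sum_(i <- r | P i) f i) = \sum_(i <- r | P i) lcoef a (f i).
Proof.
move=> fP.
suff: laurent (\sum_(i <- r | P i) f i) /\
  lcoef a (\sum_(i <- r | P i) f i) = \sum_(i <- r | P i) lcoef a (f i) by case.
apply: (big_ind2 (fun c x => laurent c /\ lcoef a c = x)).
- by split; [exact: laurent0|exact: lcoef0].
- by move=> c x c' x' [lc <-] [lc' <-]; split; [exact: laurentD|exact: lcoefD].
- by move=> i Pi; split; [exact: fP|].
Qed.

Lemma lmonE a : exists m k, (forall i, (m i)%:Z = a i + k%:Z) /\
  lmon a = tofrac 'X_[m] / tofrac (@xprod n K setT) ^+ k.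
Proof.
pose k := (\sum_i `|a i|)%N.
have ak i : 0 <= a i + k%:Z.
  have : (`|a i| <= k)%N by rewrite /k (bigD1 i) //= leq_addr.
  lia.
exists [multinom absz (a i + k%:Z)%R | i < n], k.
have E i : ([multinom absz (a i + k%:Z)%R | i < n] i)%:Z = a i + k%:Z.
  by rewrite mnmE gez0_abs.
by split=> //; apply/esym/frac_mpolyX => i; rewrite E inE muln1.
Qed.

Lemma laurent_mon a : laurent (lmon a).
Proof. by have [m [k [_ ->]]] := lmonE a; exists 'X_[m], k. Qed.

Lemma lcoef_mon a b : lcoef a (lmon b) = (b == a)%:R.
Proof.
have [m [k [mE ->]]] := lmonE b; rewrite lcoefE /shift_coef.
case: ifP => [/forallP ak|nak].
  rewrite mcoeffX; congr (nat_of_bool _)%:R; apply/eqP/eqP => [/mnmP mk|<-].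
    apply/ffunP => i; have := mk i; rewrite mnmE => mki.
    by apply: (addIr k%:Z); rewrite -mE mki gez0_abs // ak.
  by apply/mnmP => i; rewrite mnmE -mE absz_nat.
case: eqP => // ba; case/negP: (negbT nak); apply/forallP => i.
by rewrite -ba -mE.
Qed.

Lemma laurent_comb (r : seq expo) (f : expo -> K) :
  laurent (\sum_(b <- r) lconst (f b) * lmon b).
Proof. by apply: laurent_sum => b _; apply: laurentZ; apply: laurent_mon. Qed.

Lemma lcoef_comb (r : seq expo) (f : expo -> K) a :
  uniq r -> lcoef a (\sum_(b <- r) lconst (f b) * lmon b) = f a *+ (a \in r).
Proof.
move=> ur; rewrite lcoef_sum => [|b _]; last by apply/laurentZ/laurent_mon.
rewrite (eq_bigr (fun b => f b * (b == a)%:R)) => [|b _]; last first.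
  by rewrite lcoefZ ?lcoef_mon //; apply: laurent_mon.
have [ar|ar] := boolP (a \in r).
  rewrite (big_rem a) //= eqxx mulr1 big_seq big1 ?addr0 // => b.
  by rewrite mem_rem_uniq // inE => /andP[/negPf-> _]; rewrite mulr0.
rewrite big_seq big1 // => b br; case: eqP => [ba|]; rewrite ?mulr0 //.
by rewrite -ba br in ar.
Qed.

Lemma laurent_frac S k p : laurent (tofrac p / tofrac (@xprod n K S) ^+ k).
Proof.
rewrite frac_expand; apply: laurent_sum => m _.
by apply/laurentZ/laurent_mon.
Qed.

Lemma lcoef_frac_neq0 S k p a :
  lcoef a (tofrac p / tofrac (@xprod n K S) ^+ k) != 0 ->
  exists2 m, m \in msupp p & forall i, (m i)%:Z = a i + (k * (i \in S))%:Z.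
Proof.
rewrite frac_expand lcoef_sum => [|m _]; last by apply/laurentZ/laurent_mon.
move=> sum0; have /hasP[m mp ma] : has (fun m => fexp S k m == a) (msupp p).
  apply: contraR sum0 => /hasPn nof; rewrite big_seq big1 // => m mp.
  rewrite lcoefZ ?lcoef_mon; last exact: laurent_mon.
  by rewrite (negPf (nof m mp)) mulr0.
by exists m => // i; rewrite -(eqP ma) ffunE subrK.
Qed.

Lemma laurent_expand c : laurent c -> exists r : seq expo,
  [/\ uniq r, forall a, (lcoef a c != 0) = (a \in r)
    & c = \sum_(a <- r) lconst (lcoef a c) * lmon a].
Proof.
move=> [p [k cE]]; pose r0 := [seq fexp setT k m | m <- msupp p].
have ur0 : uniq r0.
  rewrite map_inj_uniq // => m m' /ffunP mm'; apply/mnmP => i.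
  by have := mm' i; rewrite !ffunE => /addIr[].
pose f (a : expo) := lcoef a c.
have cr0 : c = \sum_(a <- r0) lconst (f a) * lmon a.
  rewrite /r0 big_map {1}cE frac_expand; apply: eq_big_seq => m mp.
  congr (lconst _ * _); rewrite /f cE lcoefE /shift_coef.
  have -> : [forall i, 0 <= fexp setT k m i + k%:Z].
    by apply/forallP => i; rewrite ffunE inE muln1 subrK.
  by congr (_@__); apply/mnmP => i; rewrite mnmE ffunE inE muln1 subrK absz_nat.
exists [seq a <- r0 | f a != 0]; split; first exact: filter_uniq.
  move=> a; rewrite mem_filter /f; case: eqP => //= ca0; apply/esym.
  by apply/negPn/negP => ar; apply: ca0; rewrite cr0 lcoef_comb // (negPf ar).
rewrite big_filter {1}cr0 (bigID (fun a => f a != 0)) /= [X in _ + X]big1 ?addr0 //.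
by move=> a /negPn/eqP ->; rewrite lconst0 mul0r.
Qed.

(** An element of R_(x_S) is recognized by its exponents.  The denominator can
    be taken large enough for the exponents of the numerator on S to be at least
    k0; this takes care of the edges that meet S when the numerator has to lie
    in a power of the cover ideal. *)
Lemma laurent_frac_of S c (k0 : nat) : laurent c ->
  (forall a, lcoef a c != 0 -> forall j, j \notin S -> 0 <= a j) ->
  exists (p : R) (k : nat), c = tofrac p / tofrac (@xprod n K S) ^+ k /\
    forall m, m \in msupp p -> exists2 a, lcoef a c != 0 &
      forall i, (m i)%:Z = a i + (k * (i \in S))%:Z /\ (i \in S -> (k0 <= m i)%N).
Proof.
move=> lc cS; have [r [ur rc cr]] := laurent_expand lc.
pose k := (k0 + \sum_(a <- r) \sum_i `|a i|)%N.
have ak a i : a \in r -> (k0 + `|a i| <= k)%N.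
  move=> ar; rewrite leq_add2l (big_rem a) //= (bigD1 i) //= -addnA leq_addr //.
pose mm (a : expo) := [multinom absz (a i + (k * (i \in S))%N%:Z)%R | i < n].
have mmE a i : a \in r -> (mm a i)%:Z = a i + (k * (i \in S))%:Z.
  move=> ar; rewrite mnmE gez0_abs //.
  have [iS|iS] := boolP (i \in S); first by have := ak a i ar; lia.
  by rewrite muln0 addr0 cS // rc.
exists (\sum_(a <- r) lcoef a c *: 'X_[mm a]), k; split.
  rewrite {1}cr rmorph_sum mulr_suml; apply: eq_big_seq => a ar.
  rewrite -mul_mpolyC /= tofracM -mulrA; congr (_ * _); apply/esym/frac_mpolyX => i.
  exact: mmE.
move=> m; have [/hasP[a ar /eqP <-] _|nom] := boolP (has (fun a => mm a == m) r).
  exists a; first by rewrite rc.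
  move=> i; split; first exact: mmE.
  by move=> iS; have := mmE a i ar; have := ak a i ar; rewrite iS; lia.
rewrite mcoeff_msupp raddf_sum /= big_seq big1 ?eqxx // => a ar.
by rewrite mcoeffZ mcoeffX (negPf (hasPn nom a ar)) mulr0.
Qed.

(** Both cases of [int_homog] at once: no monomial has negative degree. *)
Lemma int_homogP (d : int) p :
  int_homog d p <-> forall m, m \in msupp p -> (mdeg m)%:Z = d.
Proof.
case: d => d /=; split.
- by move/dhomogP => H m mp; rewrite (H m mp).
- by move=> H; apply/dhomogP => m mp; have [] := H m mp.
- by move/eqP->; move=> m; rewrite msupp0.
- move=> H; apply/eqP/mpolyP => m; rewrite mcoeff0; apply/eqP.
  by rewrite mcoeff_eq0; apply/negP => /H.
Qed.

Lemma loc_homogP S t c : loc_homog S t c <->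
  laurent c /\ forall a, lcoef a c != 0 ->
    \sum_i a i = t /\ forall j, j \notin S -> 0 <= a j.
Proof.
have sumS (k : nat) : \sum_i (k * (i \in S))%:Z = (k * #|S|)%:Z.
  rewrite -sum1_card big_distrr /= (big_morph Posz PoszD erefl) [RHS]big_mkcond.
  by apply: eq_bigr => i _; case: (i \in S); rewrite ?muln1 ?muln0.
have degE m : (mdeg m)%:Z = \sum_i (m i)%:Z.
  by rewrite mdegE (big_morph Posz PoszD erefl).
split=> [[p [k [/int_homogP hp ->]]]|[lc ca]].
  split=> [|a /lcoef_frac_neq0[m mp mE]]; first exact: laurent_frac.
  split=> [|j jS].
    have := hp m mp; rewrite degE (eq_bigr _ (fun i _ => mE i)) big_split /= sumS.
    exact: addIr.
  by have := mE j; rewrite (negPf jS) muln0 addr0 => <-.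
have [|p [k [cE pk]]] := @laurent_frac_of S c 0 lc.
  by move=> a /ca[].
exists p, k; split=> //; apply/int_homogP => m /pk[a ac ma].
rewrite degE -sumS -(proj1 (ca a ac)) -big_split /=; apply: eq_bigr => i _.
by have [] := ma i.
Qed.

End Laurent.

(** * Powers of the cover ideal *)

Section CoverPowers.
Variables (n : nat) (K : fieldType) (H : hypergraph n).
Hypothesis HU : unimodular H.
Local Notation R := {mpoly K[n]}.
Local Notation J := (@cover_ideal n K H).

(** Membership in the s-th symbolic power of the cover ideal, the intersection
    of the s-th powers of the primes (x_i | i in E). *)
Definition order_ge (s : nat) (p : R) : Prop :=
  forall m, m \in msupp p -> forall E, E \in edges H -> (s <= \sum_(i in E) m i)%N.

Lemma order_ge_sum s I (r : seq I) (P : pred I) (f : I -> R) :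
  (forall i, P i -> order_ge s (f i)) -> order_ge s (\sum_(i <- r | P i) f i).
Proof.
move=> fP; apply: big_ind => //; first by move=> m; rewrite msupp0.
move=> p q pP qP m /msuppD_le; rewrite mem_cat => /orP[].
  exact: pP.
exact: qP.
Qed.

Lemma order_geM s s' (p q : R) :
  order_ge s p -> order_ge s' q -> order_ge (s + s') (p * q).
Proof.
move=> pP qP m /msuppM_le/allpairsP[[m1 m2] /= [m1p m2q ->]] E EH.
under eq_bigr do rewrite mnmDE.
by rewrite big_split leq_add ?pP ?qP.
Qed.

Lemma ideal_gen_order_ge s (I : R -> Prop) (p : R) :
  (forall q, I q -> order_ge s q) -> ideal_gen I p -> order_ge s p.
Proof.
move=> IP [k [a [g [gI ->]]]]; apply: order_ge_sum => l _.
by rewrite -[s]add0n; apply: order_geM (IP _ (gI l)).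
Qed.

Lemma xprodE (T : {set 'I_n}) : @xprod n K T = 'X_[[multinom (i \in T : nat) | i < n]].
Proof.
rewrite -[LHS]expr1 xprodX; congr 'X_[_]; apply/mnmP => i.
by rewrite !mnmE mul1n.
Qed.

Lemma cover_ideal_order_ge p : J p -> order_ge 1 p.
Proof.
apply: ideal_gen_order_ge => q [T /minsetp/forall_inP Tcov ->] m.
rewrite xprodE msuppX inE => /eqP -> E EH.
have /set0Pn[i /setIP[iT iE]] := Tcov E EH.
by rewrite (bigD1 i) //= mnmE iT.
Qed.

Lemma ideal_gen_monomials (I : R -> Prop) p :
  (forall m, m \in msupp p -> exists q g, I g /\ 'X_[m] = q * g) -> ideal_gen I p.
Proof.
move=> pI; pose P m (qg : R * R) := I qg.2 /\ 'X_[m] = qg.1 * qg.2.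
pose c m := epsilon (inhabits (0 : R, 0 : R)) (P m).
have cP m : m \in msupp p -> P m (c m).
  by move=> /pI[q [g qg]]; apply: epsilon_spec; exists (q, g).
exists (size (msupp p)),
  (fun k => p@_(nth 0%MM (msupp p) k) *: (c (nth 0%MM (msupp p) k)).1),
  (fun k => (c (nth 0%MM (msupp p) k)).2).
split=> [k|]; first by have [] := cP _ (mem_nth 0%MM (ltn_ord k)).
rewrite {1}[p]mpolyE (big_nth 0%MM) big_mkord; apply: eq_bigr => k _.
by have [_ ->] := cP _ (mem_nth 0%MM (ltn_ord k)); rewrite scalerAl.
Qed.

(** Peel off one cover at a time with [split_vertex_cover], each time shrinking
    it to a minimal one. *)
Lemma monomial_cover_power s (m : 'X_{1..n}) :
  (forall E, E \in edges H -> (s <= \sum_(i in E) m i)%N) ->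
  exists (q : R) (h : 'I_s -> R), (forall k, J (h k)) /\ 'X_[m] = q * \prod_k h k.
Proof.
elim: s m => [|s IH] m mE.
  by exists 'X_[m], (fun _ => 0); split=> [[]//|]; rewrite big_ord0 mulr1.
have [||T [Tcov Tm Ts]] := @split_vertex_cover n H HU s%:Z (fun i => (m i)%:Z) isT.
- by [].
- move=> E EH; rewrite -PoszD addn1.
  by rewrite -(big_morph Posz PoszD erefl) lez_nat mE.
have [T' T'min T'T] := minset_exists Tcov.
pose m' := [multinom (m i - (i \in T'))%N | i < n].
have mT' i : (i \in T' <= m i)%N.
  by case: (boolP (i \in T')) => // iT'; have := Tm i (subsetP T'T i iT'); lia.
have mm' : m = (m' + [multinom (i \in T' : nat) | i < n])%MM.
  by apply/mnmP => i; rewrite mnmDE !mnmE subnK.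
have [E EH|q [h [hJ m'E]]] := IH m'.
  rewrite -lez_nat; apply: le_trans (Ts E EH) _.
  rewrite (big_morph Posz PoszD erefl); apply: ler_sum => i _.
  rewrite mnmE -subzn // lerB // natz lez_nat.
  by have [/(subsetP T'T)->|] := boolP (i \in T').
exists q, (fun k => if unlift ord0 k is Some j then h j else xprod K T'); split.
  move=> k; case: unliftP => [j _|_]; first exact: hJ.
  by exists 1%N, (fun=> 1), (fun=> xprod K T'); split;
    [exists T'|rewrite big_ord1 mul1r].
rewrite mm' mpolyXD m'E -xprodE big_ord_recl unlift_none.
by under [in RHS]eq_bigr do rewrite liftK; rewrite -mulrA [in RHS](mulrC (xprod _ _)).
Qed.

(** For a unimodular hypergraph symbolic and ordinary powers coincide. *)
Lemma cover_powerP s p : ideal_exp J s p <-> order_ge s p.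
Proof.
split=> [|pP].
  apply: ideal_gen_order_ge => q [h [hJ ->]].
  elim: s h hJ => [|s IH] h hJ; first by rewrite big_ord0.
  rewrite big_ord_recl; apply: (@order_geM 1); first exact: cover_ideal_order_ge.
  by apply: IH => k; apply: hJ.
apply: ideal_gen_monomials => m mp.
have [q [h [hJ mE]]] := monomial_cover_power (pP m mp).
by exists q, (\prod_k h k); split=> //; exists h.
Qed.

(** Inverting x_S removes the conditions coming from the edges that meet S. *)
Lemma loc_cover_powerP s S c : loc_ideal (ideal_exp J s) S c <->
  laurent c /\ forall a, lcoef a c != 0 -> (forall j, j \notin S -> 0 <= a j) /\
    forall E, E \in edges H -> [disjoint E & S] -> s%:Z <= \sum_(i in E) a i.
Proof.
split=> [[p [k [/cover_powerP pP ->]]]|[lc ca]].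
  split=> [|a /lcoef_frac_neq0[m mp mE]]; first exact: laurent_frac.
  split=> [j jS|E EH dES].
    by have := mE j; rewrite (negPf jS) muln0 addr0 => <-.
  rewrite (eq_bigr (fun i => (m i)%:Z)) => [|i iE].
    by rewrite -(big_morph Posz PoszD erefl) lez_nat pP.
  by have := mE i; rewrite (disjointFr dES iE) muln0 addr0.
have [|p [k [cE pk]]] := @laurent_frac_of n K S c s lc.
  by move=> a /ca[].
exists p, k; split=> //; apply/cover_powerP => m /pk[a ac ma] E EH.
have [dES|] := boolP [disjoint E & S].
  have [_ /(_ E EH dES)] := ca a ac; rewrite -lez_nat (big_morph Posz PoszD erefl).
  move/le_trans; apply; apply: ler_sum => i iE; have [-> _] := ma i.
  by rewrite (disjointFr dES iE) muln0 addr0.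
rewrite disjoint_sym => /pred0Pn[i /andP[iS iE]]; have [_ /(_ iS) smi] := ma i.
by rewrite (bigD1 i) //= (leq_trans smi) ?leq_addr.
Qed.

End CoverPowers.

(** * Acyclicity of the strands *)

Section SupportComplex.
Variables (n : nat) (K : fieldType).
Implicit Types (S T G : {set 'I_n}) (B : {set {set 'I_n}}) (D : {set {set 'I_n}}).

Definition set_sign T (j : 'I_n) : K := (-1) ^+ #|[set k in T | (k < j)%N]|.

Definition set_diff (g : {set 'I_n} -> K) T : K :=
  \sum_(j in T) set_sign T j * g (T :\ j).

(** Exactness at cardinality i of the complex of functions supported on D with
    the Cech differential.  For D = [support_sets G B] this is the strand of the
    Cech complex of R/J^s in a degree with negative support G and low edges B;
    up to a shift it computes the reduced cohomology of a simplicial complex. *)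
Definition acyclic_at (i : nat) D : Prop :=
  forall g : {set 'I_n} -> K,
    (forall S, S \notin D -> g S = 0) ->
    (forall T, #|T| = i.+1 -> T \in D -> set_diff g T = 0) ->
    exists b : {set 'I_n} -> K, (forall S, S \notin D -> b S = 0) /\
      forall S, #|S| = i -> S \in D -> g S = set_diff b S.

Definition support_sets G B : {set {set 'I_n}} :=
  [set S : {set 'I_n} | (G \subset S) && [exists E in B, [disjoint E & S]]].

Lemma support_sets_sub G B S S' :
  S \in support_sets G B -> S' \subset S -> G \subset S' -> S' \in support_sets G B.
Proof.
rewrite !inE => /andP[_ /exists_inP[E EB dES]] S'S ->; apply/exists_inP; exists E => //.
by apply: disjointWr dES.
Qed.

Lemma acyclic_at_set0 i G : acyclic_at i (support_sets G set0).
Proof.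
move=> g g0 _; exists (fun=> 0); split=> // S _.
by rewrite inE => /andP[_ /exists_inP[E]]; rewrite inE.
Qed.

Lemma set_sign_sq T j : set_sign T j * set_sign T j = 1.
Proof. by rewrite /set_sign -expr2 sqrr_sign. Qed.

Lemma set_signU1 S j l : l \notin S ->
  set_sign (l |: S) j = (-1) ^+ (l < j)%N * set_sign S j.
Proof.
move=> lS; rewrite /set_sign -exprD; congr (_ ^+ _).
have [lj|lj] := boolP (l < j)%N.
  have -> : [set k in l |: S | (k < j)%N] = l |: [set k in S | (k < j)%N].
    by apply/setP => k; rewrite !inE; case: eqP => // ->; rewrite lj.
  by rewrite cardsU1 !inE (negPf lS).
apply: eq_card => k; rewrite !inE.
by case: eqP => // ->; rewrite (negPf lj) (negPf lS).
Qed.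

(** The anticommutation of removing j and adding l that makes the cone homotopy
    work. *)
Lemma set_signC S j l : j \in S -> l \notin S ->
  set_sign S j * set_sign (l |: (S :\ j)) l
  = - (set_sign (l |: S) l * set_sign (l |: S) j).
Proof.
move=> jS lS; have jl : j != l by apply: contraNneq lS => <-.
have lSj : l \notin S :\ j by rewrite !inE (negPf lS) andbF.
have jSj : j \notin S :\ j by rewrite !inE eqxx.
rewrite (set_signU1 _ lSj) !(set_signU1 _ lS) -[in X in _ = X](setD1K jS).
rewrite -[in X in X * _](setD1K jS) !(set_signU1 _ jSj) !ltnn !expr0 !mul1r.
by case: (ltngtP j l) jl => [_|_|/val_inj->]; rewrite ?eqxx // => _; ring.
Qed.

(** Adding or removing l does not affect membership in [support_sets G B], so
    that adding l is a contracting homotopy. *)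
Lemma acyclic_at_cone i G B l :
  l \notin G -> (forall E, E \in B -> l \notin E) -> acyclic_at i (support_sets G B).
Proof.
move=> lG lB; set D := support_sets G B.
have Dl S : (l |: S \in D) = (S \in D).
  have GE : (G \subset l |: S) = (G \subset S).
    apply/subsetP/subsetP => GS x xG; last by rewrite inE GS ?orbT.
    have := GS x xG; rewrite !inE => /orP[/eqP xl|//].
    by rewrite -xl xG in lG.
  rewrite !inE GE; congr (_ && _); apply: eq_existsb => E.
  have [EB|//] := boolP (E \in B); rewrite /= -!setI_eq0; congr (_ == _).
  by apply/setP => x; rewrite !inE; case: eqP => // ->; rewrite (negPf (lB E EB)).
move=> g g0 gclosed.
pose b S := if l \in S then 0 else set_sign (l |: S) l * g (l |: S).
exists b; split=> [S SD|S cS SD].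
  by rewrite /b; case: ifP => // _; rewrite g0 ?mulr0 // Dl.
have [lS|lS] := boolP (l \in S).
  rewrite /set_diff (bigD1 l) //= big1 ?addr0 => [|j /andP[jS jl]].
    by rewrite /b !inE eqxx /= setD1K // mulrA set_sign_sq mul1r.
  by rewrite /b !inE lS eq_sym jl mulr0.
have := gclosed (l |: S); rewrite cardsU1 lS cS Dl => /(_ erefl SD).
rewrite /set_diff big_setU1 //= setU1K // => gS.
apply: (mulfI (_ : set_sign (l |: S) l != 0)); first by rewrite signr_eq0.
move/eqP: gS; rewrite addr_eq0 => /eqP ->; rewrite -sumrN mulr_sumr.
apply: eq_bigr => j jS; have jl : j != l by apply: contraNneq lS => <-.
rewrite /b !inE (negPf lS) andbF.
have -> : (l |: S) :\ j = l |: (S :\ j).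
  apply/setP => k; rewrite !inE; case: (eqVneq k l) => [->|] //=.
  by rewrite eq_sym jl.
by rewrite (mulrA (set_sign S j)) set_signC // mulNr mulrN !mulrA set_sign_sq mul1r.
Qed.

End SupportComplex.

(** * Local cohomology in a fixed multidegree *)

Section Takayama.
Variables (n : nat) (K : fieldType) (H : hypergraph n).
Hypothesis HU : unimodular H.
Local Notation R := {mpoly K[n]}.
Local Notation F := {fraction R}.
Local Notation expo := {ffun 'I_n -> int}.
Local Notation J := (@cover_ideal n K H).
Implicit Types (S T : {set 'I_n}) (a : expo) (c b : {set 'I_n} -> F).

Definition neg_support (a : 'I_n -> int) : {set 'I_n} := [set i | a i < 0].

Definition low_edges (s : nat) (a : 'I_n -> int) : {set {set 'I_n}} :=
  [set E in edges H | [disjoint E & neg_support a] && (\sum_(i in E) a i < s%:Z)].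

Definition degree_sets s (a : 'I_n -> int) : {set {set 'I_n}} :=
  support_sets (neg_support a) (low_edges s a).

Lemma neg_supportP (a : 'I_n -> int) S :
  (forall j, j \notin S -> 0 <= a j) <-> neg_support a \subset S.
Proof.
split=> [aS|aS j jS].
  by apply/subsetP => j; rewrite inE; apply: contraTT => /aS; rewrite -leNgt.
by rewrite leNgt; apply: contra jS => aj; rewrite (subsetP aS) ?inE.
Qed.

(** In degree a the localization of R at x_S is nonzero iff S contains the
    negative support, and its quotient by J^s is nonzero iff moreover
    [degree_sets s a] contains S. *)
Lemma loc_ideal_degree_sets s S (f : F) : loc_ideal (ideal_exp J s) S f <->
  laurent f /\ forall a, lcoef a f != 0 ->
    neg_support a \subset S /\ S \notin degree_sets s a.
Proof.
rewrite (loc_cover_powerP HU); split=> -[lf fa]; split=> // a /fa [].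
  move=> /neg_supportP aS low; split=> //; rewrite inE aS /=; apply/exists_inPn => E.
  rewrite inE => /and3P[EH _]; rewrite ltNge; apply: contra; exact: low.
move=> aS SD; split; first exact/neg_supportP.
move=> E EH dES; rewrite leNgt; apply: contra SD => Es.
rewrite inE aS; apply/exists_inP; exists E => //.
by rewrite inE EH Es (disjointWr aS).
Qed.

Lemma lcoef_cech_diff a c T : (forall j, j \in T -> laurent (c (T :\ j))) ->
  laurent (cech_diff c T) /\
  lcoef a (cech_diff c T) = set_diff (fun S => lcoef a (c S)) T.
Proof.
move=> lc; rewrite /cech_diff; split.
  by apply: laurent_sum => j jT; rewrite lconst_sign; apply/laurentZ/lc.
rewrite lcoef_sum => [|j jT]; last by rewrite lconst_sign; apply/laurentZ/lc.
by apply: eq_bigr => j jT; rewrite lconst_sign lcoefZ //; apply: lc.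
Qed.

Lemma set_diff_neq0 (g : {set 'I_n} -> K) T :
  set_diff g T != 0 -> exists2 j, j \in T & g (T :\ j) != 0.
Proof.
move=> gT; apply/exists_inP; apply: contraR gT => /exists_inPn gT.
by rewrite /set_diff big1 // => j /gT/negPn/eqP->; rewrite mulr0.
Qed.

(** A face that leaves [degree_sets s a] no longer contains the negative
    support, so that x^a does not occur in the localization at that face.
    Hence the differential at S in degree a is that of the strand. *)
Lemma degree_setsN s a S j : S \in degree_sets s a -> S :\ j \notin degree_sets s a ->
  ~~ (neg_support a \subset S :\ j).
Proof.
by move=> SD; apply: contra => /(support_sets_sub SD); apply; rewrite subsetDl.
Qed.

Lemma degree_sets_neg s a S : S \in degree_sets s a -> neg_support a \subset S.
Proof. by rewrite inE => /andP[]. Qed.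

Lemma eq_set_diff (g g' : {set 'I_n} -> K) T :
  (forall j, j \in T -> g (T :\ j) = g' (T :\ j)) -> set_diff g T = set_diff g' T.
Proof. by move=> gg'; apply: eq_bigr => j jT; rewrite gg'. Qed.

Lemma cardsD1_pred i T j : j \in T -> #|T| = i -> #|T :\ j| = i.-1.
Proof. by move=> jT <-; rewrite (cardsD1 j T) jT. Qed.

Lemma laurent_sub (f g : F) : laurent f -> laurent g ->
  laurent (f - g) /\ forall a, lcoef a (f - g) = lcoef a f - lcoef a g.
Proof.
move=> lf lg; have -> : f - g = f + lconst n (-1) * g.
  by rewrite -(expr1 (-1 : K)) -lconst_sign expr1 mulN1r.
have l' := laurentZ (-1) lg; split; first exact: laurentD.
by move=> a; rewrite lcoefD // lcoefZ // mulN1r.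
Qed.

(** A nontrivial class of the strand, multiplied by x^a, is a nontrivial class
    of the Cech complex. *)
Lemma local_cohomology_degree s i t a :
  \sum_i a i = t -> ~ acyclic_at K i (degree_sets s a) ->
  local_cohomology_neq0 (ideal_exp J s) i t.
Proof.
move=> at_ nacyc; set D := degree_sets s a in nacyc.
have {nacyc}[g [g0 gcl gnb]] : exists g : {set 'I_n} -> K,
  [/\ forall S, S \notin D -> g S = 0,
      forall T, #|T| = i.+1 -> T \in D -> set_diff g T = 0
    & ~ exists b : {set 'I_n} -> K, (forall S, S \notin D -> b S = 0) /\
          forall S, #|S| = i -> S \in D -> g S = set_diff b S].
  apply: NNPP => H'; apply: nacyc => g g0 gcl; apply: NNPP => gnb.
  by apply: H'; exists g.
pose c S : F := lconst n (g S) * lmon K a.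
have lc S : laurent (c S) by apply/laurentZ/laurent_mon.
have cE a' S : lcoef a' (c S) = g S *+ (a == a').
  by rewrite /c lcoefZ ?lcoef_mon ?mulr_natr //; apply: laurent_mon.
exists c; split.
- move=> S _; apply/loc_homogP; split=> // a'; rewrite cE.
  have [<-|] := eqVneq a a'; last by rewrite eqxx.
  move=> gS; split=> //; apply/neg_supportP.
  have SD : S \in D by apply: contraR gS => /g0->.
  exact: degree_sets_neg SD.
- move=> T cT; apply/loc_ideal_degree_sets.
  have [lT _] := @lcoef_cech_diff a c T (fun j _ => lc _).
  split=> // a'; rewrite (proj2 (@lcoef_cech_diff a' c T (fun j _ => lc _))).
  have [<-|aa'] := eqVneq a a'; last first.
    by move/set_diff_neq0 => [j _]; rewrite cE (negPf aa') eqxx.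
  rewrite (@eq_set_diff _ g) => [dT|j _]; last by rewrite cE eqxx.
  split; last by apply: contra dT => TD; rewrite gcl.
  have [j jT gj] := set_diff_neq0 dT.
  have jD : T :\ j \in D by apply: contraR gj => /g0->.
  exact: subset_trans (degree_sets_neg jD) (subsetDl _ _).
move=> [b [bhom bc]]; apply: gnb.
have lb S j : #|S| = i -> j \in S -> laurent (b (S :\ j)).
  by move=> cS jS; have /loc_homogP[] := bhom _ (cardsD1_pred jS cS).
exists (fun S => if S \in D then lcoef a (b S) else 0); split.
  by move=> S /negPf->.
move=> S cS SD; have [lS dS] := lcoef_cech_diff a (lb S ^~ cS).
have /loc_ideal_degree_sets[_ /(_ a)] := bc S cS.
have [_ ->] := laurent_sub (lc S) lS; rewrite cE eqxx dS => res0.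
transitivity (set_diff (fun S => lcoef a (b S)) S).
  apply/eqP; rewrite -subr_eq0; apply: contraT => /res0[_].
  by rewrite SD.
apply: eq_set_diff => j jS; case: ifP => // /negbT SjD.
apply/eqP; apply: contraT => bj.
have /loc_homogP[_ /(_ a bj)[_ /neg_supportP]] := bhom _ (cardsD1_pred jS cS).
by rewrite (negPf (degree_setsN SD SjD)).
Qed.

(** A cocycle is a coboundary as soon as it is one in each degree a.  Only
    finitely many a occur in it, so the primitives found in the various degrees
    can be added up. *)
Lemma local_cohomology_acyclic s i t :
  (forall a, \sum_i a i = t -> acyclic_at K i (degree_sets s a)) ->
  ~ local_cohomology_neq0 (ideal_exp J s) i t.
Proof.
move=> acyc [c [chom ccl]]; apply.
have lc S : #|S| = i -> laurent (c S) by move/chom/loc_homogP=> [].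
pose D a := degree_sets s a.
pose P a (g : {set 'I_n} -> K) := (forall S, S \notin D a -> g S = 0) /\
   forall S, #|S| = i -> S \in D a -> lcoef a (c S) = set_diff g S.
have exP a : \sum_i a i = t -> exists g, P a g.
  move=> at_; pose g S := if (S \in D a) && (#|S| == i) then lcoef a (c S) else 0.
  have [S /negPf SD|T cT TD|b [b0 gb]] := acyc a at_ g; rewrite /g.
  - by rewrite SD.
  - have cTj j : j \in T -> #|T :\ j| = i by move=> jT; rewrite (cardsD1_pred jT cT).
    have [lT dT] := lcoef_cech_diff a (fun j jT => lc _ (cTj j jT)).
    rewrite (@eq_set_diff _ (fun S => lcoef a (c S))) => [|j jT].
      rewrite -dT; have /loc_ideal_degree_sets[_ /(_ a) res0] := ccl T cT.
      by apply/eqP; apply: contraT => /res0[_]; rewrite TD.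
    rewrite cTj // eqxx andbT; case: ifP => // /negbT TjD.
    apply/esym/eqP; apply: contraT => bj.
    have /loc_homogP[_ /(_ a bj)[_ /neg_supportP]] := chom _ (cTj j jT).
    by rewrite (negPf (degree_setsN TD TjD)).
  - exists b; split=> // S cS SD; rewrite -gb // /g.
    by have -> : (S \in D a) && (#|S| == i) by rewrite SD cS eqxx.
pose g a := epsilon (inhabits (fun _ : {set 'I_n} => 0 : K)) (P a).
have gP a : \sum_i a i = t -> P a (g a) by move=> /exP; apply: epsilon_spec.
(* r lists the exponents that occur in c. *)
have [r [ur rt rc]] : exists r : seq expo, [/\ uniq r,
    forall a, a \in r -> \sum_i a i = t
  & forall S a, #|S| = i -> lcoef a (c S) != 0 -> a \in r].
  pose rS S := epsilon (inhabits [::])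
    (fun r : seq expo => forall a, lcoef a (c S) != 0 -> a \in r).
  exists (undup [seq a : expo <- flatten [seq rS A | A : {set 'I_n}] | \sum_i a i == t]).
  split; first exact: undup_uniq.
    by move=> a; rewrite mem_undup mem_filter => /andP[/eqP].
  move=> S a cS ca; rewrite mem_undup mem_filter.
  have /loc_homogP[_ /(_ a ca)[-> _]] := chom S cS.
  rewrite eqxx; apply/flattenP; exists (rS S).
    by apply/mapP; exists S => //; rewrite mem_enum.
  have [r [_ rE _]] := laurent_expand (lc S cS).
  have : exists r : seq expo, forall a, lcoef a (c S) != 0 -> a \in r.
    by exists r => a'; rewrite rE.
  by move/(epsilon_spec (inhabits [::])); apply.
pose b S : F := \sum_(a <- r) lconst n (g a S) * lmon K a.
have lb S : laurent (b S) by apply: laurent_comb.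
have bE a S : lcoef a (b S) = g a S *+ (a \in r) by apply: lcoef_comb.
exists b; split.
  move=> S _; apply/loc_homogP; split=> // a; rewrite bE.
  have [ar|] := boolP (a \in r); last by rewrite eqxx.
  rewrite mulr1n => gS; have at_ := rt a ar; split=> //; apply/neg_supportP.
  have SD : S \in D a by apply: contraR gS => /(proj1 (gP a at_))->.
  exact: degree_sets_neg SD.
move=> S cS; apply/loc_ideal_degree_sets.
have lbS a := @lcoef_cech_diff a b S (fun j _ => lb _).
have [l' dE] := laurent_sub (lc S cS) (proj1 (lbS [ffun=> 0])).
split=> // a; rewrite dE (proj2 (lbS a)).
have [ar|ar] := boolP (a \in r); last first.
  rewrite (_ : lcoef a (c S) = 0) ?sub0r ?oppr_eq0; last first.
    by apply/eqP; apply: contraR ar; apply: rc.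
  by move/set_diff_neq0 => [j _]; rewrite bE (negPf ar) eqxx.
have at_ := rt a ar; have [g0 gd] := gP a at_.
rewrite (@eq_set_diff _ (g a)) => [res|j _]; last by rewrite bE ar.
split; last first.
  by apply: contra res => SD; rewrite gd // subrr.
have [cS0|cS0] := eqVneq (lcoef a (c S)) 0; last first.
  by have /loc_homogP[_ /(_ a cS0)[_ /neg_supportP]] := chom S cS.
move: res; rewrite cS0 sub0r oppr_eq0 => /set_diff_neq0[j jS gj].
have jD : S :\ j \in D a by apply: contraR gj => /g0->.
exact: subset_trans (degree_sets_neg jD) (subsetDl _ _).
Qed.

(** The form of Takayama's formula on which everything rests: s enters only
    through [degree_sets s a]. *)
Lemma local_cohomologyP s i t : local_cohomology_neq0 (ideal_exp J s) i t <->
  exists2 a : expo, \sum_i a i = t & ~ acyclic_at K i (degree_sets s a).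
Proof.
split=> [Ht|[a at_ na]]; last exact: local_cohomology_degree at_ na.
apply: NNPP => nex; apply: (@local_cohomology_acyclic s i t) Ht => a at_.
by apply: NNPP => na; apply: nex; exists a.
Qed.

End Takayama.

(** * Asymptotic linearity of the a-invariants *)

Section Regions.
Variables (n : nat) (H : hypergraph n).

(** Raising the negative coordinates to -1 changes neither the negative support
    nor the low edges, and does not decrease the total degree. *)
Lemma region_of_degree s (a : 'I_n -> int) :
  let a' i := if i \in neg_support a then -1 else a i in
  in_region H (neg_support a) (low_edges H s a) (-1) (s%:Z - 1) s%:Z a' /\
  \sum_i a i <= \sum_i a' i.
Proof.
move=> a'; have sumE (E : {set 'I_n}) : [disjoint E & neg_support a] ->
    \sum_(i in E) a' i = \sum_(i in E) a i.
  by move=> dE; apply: eq_bigr => i iE; rewrite /a' (disjointFr dE iE).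
split; [split|].
- by move=> i iG; rewrite /a' iG.
- by move=> i iG; rewrite /a' (negPf iG); move: iG; rewrite inE -leNgt.
- by move=> E; rewrite inE => /and3P[_ dE]; rewrite sumE //; lia.
- by move=> E EH dE; rewrite inE EH dE sumE //= -leNgt.
apply: ler_sum => i _; rewrite /a'; case: ifP => //.
by rewrite inE; lia.
Qed.

Lemma degree_of_region (G : {set 'I_n}) (B : {set {set 'I_n}}) s (a : 'I_n -> int) :
  (forall E, E \in B -> E \in edges H /\ [disjoint E & G]) ->
  in_region H G B (-1) (s%:Z - 1) s%:Z a ->
  neg_support a = G /\ low_edges H s a = B.
Proof.
move=> BH [aG a0 aB aC].
have nG : neg_support a = G.
  apply/setP => i; rewrite inE; have [/aG->//|/a0] := boolP (i \in G).
  by rewrite leNgt => /negPf.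
split=> //; apply/setP => E; rewrite inE nG; apply/and3P/idP => [[EH dE]|EB].
  by apply: contraTT => EB; rewrite -leNgt aC.
by have [EH dE] := BH E EB; split=> //; apply: le_lt_trans (aB E EB) _; lia.
Qed.

End Regions.

Theorem theorem3p2 (n : nat) (hn : (1 <= n)%N) (K : fieldType)
    (H : hypergraph n) (HU : unimodular H) (i : nat)
    (hi : le_dim_quot i (@cover_ideal n K H)) :
  (forall s : nat, (1 <= s)%N ->
     is_a_invariant (ideal_exp (@cover_ideal n K H) s) i None) \/
  (exists d e : nat, [/\ (0 < d)%N, (0 < e)%N, (d <= e)%N &
     forall s : nat, (n ^ 2 <= s)%N ->
       is_a_invariant (ideal_exp (@cover_ideal n K H) s) i
         (Some ((d * s)%:Z - e%:Z))]).
Proof.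
pose region (G : {set 'I_n}) (B : {set {set 'I_n}}) (s : nat) :=
  in_region H G B (-1) (s%:Z - 1) s%:Z.
pose proper (G : {set 'I_n}) (B : {set {set 'I_n}}) :=
  forall E, E \in B -> E \in edges H /\ [disjoint E & G].
pose good G B := [/\ proper G B, ~ acyclic_at K i (support_sets G B)
  & exists (s : nat) (a : 'I_n -> int), (0 < s)%N /\ region G B s a].
pose growth G B (d e : nat) := forall s, (n ^ 2 <= s)%N ->
   (exists a : 'I_n -> int, region G B s a /\ \sum_i a i = (d * s)%:Z - e%:Z) /\
   (forall a : 'I_n -> int, region G B s a -> \sum_i a i <= (d * s)%:Z - e%:Z).
have good_growth G B : good G B -> exists d e : nat,
    [/\ (0 < d)%N, (d <= e)%N, (e <= n ^ 2)%N & growth G B d e].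
  move=> [BH nacyc reg]; apply: region_growth => //.
  - move=> l lG; apply: NNPP => noE; apply: nacyc.
    apply: (@acyclic_at_cone _ _ _ _ _ l) => //.
    by move=> E EB; apply/negP => lE; apply: noE; exists E.
  - apply: NNPP => noE; apply: nacyc.
    have -> : B = set0.
      by apply/setP => E; rewrite inE; apply/negP => EB; apply: noE; exists E.
    exact: acyclic_at_set0.
have cohom_good s t : (0 < s)%N ->
    local_cohomology_neq0 (ideal_exp (@cover_ideal n K H) s) i t ->
    exists G B a, [/\ good G B, region G B s a & t <= \sum_i a i].
  move=> s0 /(local_cohomologyP K HU)[a <- nacyc].
  have [aP aa'] := region_of_degree H s a.
  exists (neg_support a), (low_edges H s a); eexists; split; [|exact: aP|exact: aa'].
  split=> //; last by exists s; eexists; split; [|exact: aP].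
  by move=> E; rewrite inE => /and3P[].
case: (classic (exists G B, good G B)) => [[G0 [B0 good0]]|nogood]; last first.
  left=> s s1 t /(cohom_good s t s1)[G [B [a [gGB _ _]]]].
  by apply: nogood; exists G, B.
right.
(* Since 0 <= e <= n ^ 2, maximizing the single number d (n ^ 2 + 1) - e is the
   same as maximizing d first and minimizing e next. *)
pose value (k : int) := exists G B (d e : nat),
  [/\ good G B, growth G B d e, (0 < d)%N, (d <= e)%N & (e <= n ^ 2)%N /\
      k = d%:Z * ((n ^ 2)%N%:Z + 1) - e%:Z].
have [||k [[G [B [d [e [gGB grow d0 de [en kE]]]]]] kmax]] := @int_ex_max value
    ((n ^ 2)%N%:Z * ((n ^ 2)%N%:Z + 1)).
- have [d [e [d0 de en grow]]] := good_growth _ _ good0.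
  by exists (d%:Z * ((n ^ 2)%N%:Z + 1) - e%:Z), G0, B0, d, e; split.
- move=> k [G [B [d [e [_ _ d0 de [en ->]]]]]].
  have : d%:Z <= (n ^ 2)%N%:Z by rewrite lez_nat (leq_trans de).
  by move: ((n ^ 2)%N%:Z) => N; nia.
exists d, e; split=> //; first exact: leq_trans de.
move=> s ns; have [[a [aP aE]] amax] := grow s ns.
have s0 : (0 < s)%N by apply: leq_trans ns; rewrite expn_gt0 hn.
split.
  have [BH nacyc _] := gGB; have [nG nB] := degree_of_region BH aP.
  apply/(local_cohomologyP K HU); exists (finfun a).
    by rewrite -aE; apply: eq_bigr => j _; rewrite ffunE.
  have -> : degree_sets H s (finfun a) = support_sets G B; last by [].
  have nE : neg_support (finfun a) = neg_support a.
    by apply/setP => j; rewrite !inE ffunE.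
  rewrite /degree_sets nE nG; congr (support_sets _ _); rewrite -nB.
  apply/setP => E; rewrite !inE nE (eq_bigr a) // => j _.
  exact: ffunE.
move=> t /(cohom_good s t s0)[G' [B' [a' [gGB' a'P ta']]]].
have [d' [e' [d'0 de' en' grow']]] := good_growth _ _ gGB'.
have [_ /(_ a' a'P) a'max] := grow' s ns.
apply: le_trans ta' (le_trans a'max _).
have : value (d'%:Z * ((n ^ 2)%N%:Z + 1) - e'%:Z) by exists G', B', d', e'.
move/kmax; rewrite kE; move: ns en en'; rewrite -!lez_nat !PoszM.
move: ((n ^ 2)%N%:Z) (s%:Z) => N x xN eN e'N val.
have [dd|dd] := ltnP d d'.
  have : d%:Z + 1 <= d'%:Z by lia.
  by nia.
have [dd'|] := eqVneq d d'; first by rewrite -dd' in val *; lia.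
move=> dd'; have : d'%:Z + 1 <= d%:Z by lia.
by nia.
Qed.
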